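(* If $T$ is a tree on twenty vertices, one of which has degree ten, then the chromatic symmetric function $X_T(\mathbf{x})$ is not Schur positive.
   Context: For a finite simple graph $G=(V,E)$, a proper coloring is a function $\kappa:V\to\mathbb{P}$ (positive integers) with $\kappa(v)\neq\kappa(w)$ whenever $\{v,w\}\in E$. With commuting variables $\mathbf{x}=\{x_i: i\in\mathbb{P}\}$, the chromatic symmetric function is $X_G(\mathbf{x})=\sum_{\kappa}\prod_{v\in V}x_{\kappa(v)}$, the sum over all proper colorings $\kappa$ of $G$. A symmetric function is Schur positive if all coefficients in its expansion in the basis of Schur functions are nonnegative. *)

(* Defs.v *)
From HB Require Import structures.
From mathcomp Require Import all_boot all_order all_algebra finmap.
From mathcomp Require Import boolp classical_sets functions cardinality fsbigop.
From mathcomp.multinomials Require Import monalg.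

Set Implicit Arguments.
Unset Strict Implicit.
Unset Printing Implicit Defensive.

Import GRing.Theory.
Local Open Scope ring_scope.

Record sgraph := SGraph {
  vertex :> finType;
  adj : rel vertex;
  adj_sym : symmetric adj;
  adj_irr : irreflexive adj
}.

Definition degree (G : sgraph) (v : G) : nat := #|[set w | adj v w]|.

Definition connected_graph (G : sgraph) : Prop :=
  (0 < #|G|)%N /\ forall x y : G, connect (@adj G) x y.

(* The bound on the size discards [:: x; y], which [cycle] accepts for every
   edge {x, y}. *)
Definition acyclic (G : sgraph) : Prop :=
  forall s : seq G, (2 < size s)%N -> ~ ucycle (@adj G) s.

Definition is_tree (G : sgraph) : Prop := connected_graph G /\ acyclic G.

(* Formal power series over rat in the variables x_0, x_1, x_2, ..., given by
   their coefficients. The variables are indexed by nat instead of the positive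
   integers: the index i stands for i + 1. *)
Definition fps := {cmonom nat} -> rat.

Definition fmonomial (F : finType) (f : {ffun F -> nat}) : {cmonom nat} :=
  \big[mmul/mone]_(z : F) ucm (f z).

(* The series \sum_(f in A) \prod_z x_(f z). Sums [\sum_(i \in A)] with
   infinitely many nonzero terms are 0 by convention; [fmonomial_fiber_finite]
   shows that this never happens here. *)
Definition generating_series (F : finType) (A : set {ffun F -> nat}) : fps :=
  fun m => \sum_(f \in [set f | A f /\ fmonomial f = m]%classic) (1 : rat).

Lemma fmonomialE (F : finType) (f : {ffun F -> nat}) (i : nat) :
  fmonomial f i = #|[set z | f z == i]|.
Proof.
rewrite -sum1_card big_mkcond /= /fmonomial.
elim/big_ind2: _ => [|m a m' a' <- <-|z _]; first by rewrite cm1.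
  by rewrite cmM.
by rewrite cmU inE; case: eqP.
Qed.

Lemma fmonomial_fiber_finite (F : finType) (A : set {ffun F -> nat})
    (m : {cmonom nat}) :
  finite_set [set f | A f /\ fmonomial f = m]%classic.
Proof.
pose N := (\max_(i <- finsupp m) i).+1.
pose emb (g : {ffun F -> 'I_N}) : {ffun F -> nat} := [ffun z => val (g z)].
apply: (@sub_finite_set _ _ (emb @` [set: {ffun F -> 'I_N}])%classic).
  move=> f [_ fm].
  have f_lt z : (f z < N)%N.
    rewrite ltnS; apply: (leq_bigmax_seq (F := id)) => //.
    rewrite mem_finsupp -fm fmonomialE -lt0n; apply/card_gt0P.
    by exists z; rewrite inE.
  by exists [ffun z => Ordinal (f_lt z)] => //; apply/ffunP => z; rewrite !ffunE.
exact/finite_image/finite_finset.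
Qed.

Definition proper_coloring (G : sgraph) (k : {ffun G -> nat}) : Prop :=
  forall v w : G, adj v w -> k v <> k w.

Definition chromatic_sym (G : sgraph) : fps :=
  generating_series [set k | @proper_coloring G k]%classic.

Definition is_partition (la : seq nat) : bool :=
  sorted geq la && (0%N \notin la).

Definition partition := {la : seq nat | is_partition la}.

(* The cells (i, j) of the Young diagram of la, with j < la_i. *)
Definition cell (la : partition) : finType :=
  {i : 'I_(size (val la)) & 'I_(nth 0%N (val la) i)}.

Definition cell_row (la : partition) (c : cell la) : nat := tag c.
Definition cell_col (la : partition) (c : cell la) : nat := tagged c.

Definition semistandard (la : partition) (t : {ffun cell la -> nat}) : Prop :=
  (forall c d : cell la, cell_row c = cell_row d ->
     (cell_col c <= cell_col d)%N -> (t c <= t d)%N) /\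
  (forall c d : cell la, cell_col c = cell_col d ->
     (cell_row c < cell_row d)%N -> (t c < t d)%N).

Definition schur (la : partition) : fps :=
  generating_series [set t | @semistandard la t]%classic.

Definition schur_expansion (c : {fsfun partition -> rat with 0}) (f : fps)
    : Prop :=
  forall m, f m = \sum_(la <- finsupp c) c la * schur la m.

(* Since the Schur functions are linearly independent, c is unique. *)
Definition schur_positive (f : fps) : Prop :=
  exists2 c : {fsfun partition -> rat with 0},
    schur_expansion c f & forall la, 0 <= c la.

(* Main.v *)
Require Import Defs.
From mathcomp Require Import classical_sets fsbigop.
From mathcomp Require Import all_boot all_order all_algebra finmap.
From mathcomp.multinomials Require Import monalg.
From mathcomp Require Import ssrZ zify ring lra.

(* A positive combination of Schur functions satisfies every linear inequality
   between coefficients that all Schur functions satisfy.  Three are used: with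
   [a_1, ..., a_r] the coefficient of x_1^a_1 ... x_r^a_r,
     [a, b] <= [k, k]                      for a + b = 2k and a >= k,
     [k+3, k, 1] + [k+2, k+2] <= [k+2, k+1, 1] + [k+4, k],
     <f, e_(k+1) e_(k-1)> <= <f, e_k e_k>.
   (The differences extract the coefficients of s_(k+2, k+1, 1) and of s_(2^k)
   in the last two cases.)

   For the tree T the first inequality, with k = 10, makes the 10 neighbours of
   the vertex v of degree 10 and their complement both stable.  So T is v joined
   to 10 children, which carry c_1, ..., c_10 leaves with sum 9, and there are
   30 cases.  Both sides of the other two inequalities are then coefficients of
   explicit polynomials in the c_i, because <X_T, e_a e_b> counts the
   two-colourings with class sizes a and b, each weighted by
   2^(number of monochromatic edges).  In every case one of the two inequalities
   fails. *)

(** One counting scheme serves both sides. A semistandard tableau or a proper colouring is a chain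
    of sublevel sets, restricted by a relation between consecutive sets: horizontal strips for Schur
    functions, stable differences for chromatic ones. A coefficient is then a number of chains with
    prescribed step sizes. Pairing with e_a e_b is an alternating sum of such numbers; up to signs
    it replaces the step relation by its inverse in the incidence algebra of sets. Horizontal strips
    are inverted by vertical strips, so the third inequality is the first one for transposed
    diagrams. Stable differences on a forest are inverted by the number of acyclic orientations,
    hence the powers of 2. In the second inequality, a last letter used once amounts to deleting a
    vertex, after which only proper two-colourings of a forest remain to be counted. *)

Set Implicit Arguments.
Unset Strict Implicit.
Unset Printing Implicit Defensive.

Import Order.TTheory GRing.Theory Num.Theory.

(** * Coefficients as numbers of chains of sets *)

(* Contents are listed from the last letter to the first. *)
Definition content_monomial (s : seq nat) : {cmonom nat} :=
  mkcmonom [fsfun i in [fset j in iota 0 (size s)]%fset =>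
              nth 0 (rev s) i | 0].

Lemma content_monomialE s i : content_monomial s i = nth 0 (rev s) i.
Proof.
rewrite cmE fsfun_fun !inE /= mem_iota add0n /=.
by case: ltnP => // le_s_i; rewrite nth_default ?size_rev.
Qed.

Section Chains.
Variables (F : finType) (R : rel {set F}).

(** [B] and [W] are consecutive sublevel sets, so [W :\: B] holds the occurrences of one letter. *)
Fixpoint chains (s : seq nat) (W : {set F}) : nat :=
  if s is g :: s' then
    \sum_(B : {set F} | [&& B \subset W, #|W :\: B| == g & R B W]) chains s' B
  else W == set0.

Definition below n (t : {ffun F -> 'I_n}) (k : nat) : {set F} :=
  [set c | t c < k].

Lemma in_below n (t : {ffun F -> 'I_n}) k c : (c \in below t k) = (t c < k).
Proof. by rewrite inE. Qed.

(* The cells outside W carry the value [size s], which is not a letter; peeling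
   off the last letter then lowers these cells along with it. *)
Definition fillings n (s : seq nat) (W : {set F}) : {set {ffun F -> 'I_n}} :=
  [set t | [&& below t (size s) == W, [forall c, t c <= size s],
     [forall k : 'I_(size s), R (below t k) (below t k.+1)] &
     [forall k : 'I_(size s), #|[set c | t c == k :> nat]| == nth 0 (rev s)
       k]]].

(** The fillings are sorted by the set [B] of cells below the last letter; those with a given [B]
    correspond to the fillings of [B] by the other letters. Keeping [n] fixed gives all these
    fillings one type. *)
Lemma card_fillings n s W : size s < n -> #|fillings n s W| = chains s W.
Proof.
elim: s W => [|g s IHs] W /= ltsn.
  have [->|W0] := eqVneq W set0; last first.
    apply/eqP; rewrite cards_eq0; apply/eqP/setP => t; rewrite !inE.
    apply/negP => /and4P[/eqP tW _ _ _]; move: W0; rewrite -tW => /set0Pn[c].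
    by rewrite !inE.
  apply/eqP/cards1P; exists [ffun=> Ordinal ltsn].
  apply/setP => t; rewrite !inE; apply/and4P/eqP => [[_ /forallP t0 _ _]|->].
    by apply/ffunP => c; apply/val_inj; rewrite ffunE /=; have := t0 c;
      rewrite leqn0 => /eqP.
  split; try by apply/forallP => -[].
    by apply/eqP/setP => c; rewrite !inE.
  by apply/forallP => c; rewrite ffunE.
move Ek: (size s) ltsn => k ltsn.
rewrite -sum1_card (partition_big (fun t => below t k)
  (fun B => [&& B \subset W, #|W :\: B| == g & R B W])) /=; last first.
  move=> t; rewrite inE /= Ek => /and4P[/eqP tW tk tR tn].
  have -> : R (below t k) W by rewrite -tW; move/forallP/(_ ord_max): tR.
  have -> : below t k \subset W.
    by rewrite -tW; apply/fintype.subsetP => c; rewrite !inE; exact: leqW.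
  move/forallP/(_ ord_max): tn; rewrite /= nth_rev /= ?Ek // subSS subnn /= =>
    /eqP <-.
  rewrite andbT /= -tW; apply/eqP/eq_card => c; rewrite !inE.
  by rewrite -leqNgt ltnS eqn_leq andbC.
apply: eq_bigr => B /and3P[BW cardB RBW]; rewrite sum1_card.
rewrite -IHs ?Ek ?(ltnW ltsn) //.
pose o i : 'I_n := insubd (Ordinal ltsn) i.
have oE i : i <= k.+1 -> o i = i :> nat.
  by move=> ?; rewrite /o val_insubd; case: ltnP => //; lia.
(* The inverse of peeling off the last letter [k]: cells of [W :\: B] receive [k], and cells outside
   [W] are raised to the new non-letter [k.+1]. *)
pose phi (t : {ffun F -> 'I_n}) : {ffun F -> 'I_n} :=
  [ffun c => if c \in B then t c else if c \in W then o k else o k.+1].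
rewrite -(@card_in_imset _ _ phi (fillings n s B)); last first.
  move=> t u; rewrite !inE Ek => /and4P[/eqP tB /forallP tk _ _].
  move=> /and4P[/eqP uB /forallP uk _ _] /ffunP eq_tu.
  apply/ffunP => c; have := eq_tu c; rewrite !ffunE.
  case: ifP => // cB _; apply/val_inj => /=.
  have tc : nat_of_ord (t c) = k.
    by apply/eqP; rewrite eqn_leq tk leqNgt -in_below tB cB.
  have uc : nat_of_ord (u c) = k.
    by apply/eqP; rewrite eqn_leq uk leqNgt -in_below uB cB.
  exact: etrans tc (esym uc).
apply/eq_card => t; rewrite unfold_in /= inE /= Ek.
have nthE (j : nat) : j < k -> nth 0 (rev (g :: s)) j = nth 0 (rev s) j.
  by move=> jk; rewrite rev_cons nth_rcons size_rev Ek jk.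
apply/idP/imsetP => [|[u]].
  move=> /andP[/and4P[/eqP tW /forallP tk /forallP tR /forallP tn] /eqP tB].
  exists [ffun c => if c \in B then t c else o k].
    have bE j : j <= k ->
        below [ffun c => if c \in B then t c else o k] j = below t j.
      move=> jk; apply/setP => c; rewrite !inE ffunE -tB !inE.
      by case: (ltnP (t c) k) => // ktc; rewrite oE //; move: ktc;
        move: (nat_of_ord (t c)) => x; lia.
    rewrite inE Ek bE // tB eqxx /=; apply/and3P; split.
    - apply/forallP => c; rewrite ffunE -tB !inE.
      by case: ifP => [/ltnW //|_]; rewrite oE.
    - apply/forallP => j; rewrite !bE //; last by rewrite ltnW.
      by have := tR (widen_ord (leqnSn _) j).
    - apply/forallP => j; rewrite -nthE //.
      have /eqP <- := tn (widen_ord (leqnSn _) j).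
      apply/eqP/eq_card => c; rewrite !inE ffunE -tB !inE /=.
      have := ltn_ord j; move: (val j) => i; rewrite ?Ek => ik.
      by case: (ltnP (t c) k) => // ktc; rewrite oE //; move: ktc;
        move: (nat_of_ord (t c)) => x; lia.
  apply/ffunP => c; apply/val_inj; rewrite !ffunE.
  have tkc := tk c; rewrite -tB -tW !inE.
  case: (ltnP (t c) k) => //= ktc; case: (ltnP (t c) k.+1) => ktc1.
    by rewrite oE // ; apply/eqP; rewrite eqn_leq ktc -ltnS ktc1.
  by rewrite oE //; apply/eqP; rewrite eqn_leq ktc1 tkc.
rewrite inE Ek => /and4P[/eqP uB /forallP uk /forallP uR /forallP un] ->.
have uBE c : (u c < k) = (c \in B) by rewrite -uB inE.
have bE j : j <= k -> below (phi u) j = below u j.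
  move=> jk; apply/setP => c; rewrite !inE ffunE -uBE.
  have := uk c; case: (ltnP (u c) k) => // ktc ukc.
  have ujF : (u c < j) = false by rewrite ltnNge (leq_trans jk ktc).
  by case: ifP => _; rewrite oE // ujF ltnNge ?jk // leqW.
have bkE : below (phi u) k.+1 = W.
  apply/setP => c; rewrite !inE ffunE -uBE; case: (ltnP (u c) k) => cu.
    by rewrite ltnW // (fintype.subsetP BW) // -uBE.
  by case: ifP => cW; rewrite oE // ?ltnSn ?ltnn.
rewrite bkE eqxx bE // uB eqxx andbT /=; apply/and3P; split.
- apply/forallP => c; rewrite ffunE -uBE.
  by case: ifP => [/ltnW/leqW //|_]; case: ifP; rewrite oE.
- apply/forallP => -[j /=]; rewrite ltnS leq_eqVlt => /orP[/eqP ->|jk].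
    by rewrite bkE bE // uB.
  by rewrite !bE //; last (exact: ltnW); have := uR (Ordinal jk).
- apply/forallP => -[j /=]; rewrite ltnS leq_eqVlt => /orP[/eqP ->|jk].
    rewrite rev_cons nth_rcons size_rev Ek ltnn eqxx.
    rewrite -(eqP cardB); apply/eqP/eq_card => c; rewrite !inE ffunE -uBE.
    have [cu|cu] := ltnP (u c) k; first by rewrite (ltn_eqF cu).
    by case: ifP => cW; rewrite oE // ?eqxx // gtn_eqF.
  rewrite nthE //; have /eqP <- := un (Ordinal jk).
  apply/eqP/eq_card => c; rewrite !inE ffunE -uBE /=.
  have [//|cu] := ltnP (u c) k.
  rewrite [RHS]gtn_eqF; last exact: leq_trans cu.
  by case: ifP => cW; rewrite oE // gtn_eqF // ltnW.
Qed.

(** The condition on [t] concerns every [k], while a filling only records the letters below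
    [size s]. From there on all sublevel sets are [setT], which is where [R setT setT] enters. *)
Lemma generating_seriesE (A : set {ffun F -> nat}) s :
  R setT setT ->
  (forall t : {ffun F -> nat}, A t <->
     forall k, R [set c | t c < k] [set c | t c < k.+1]) ->
  generating_series A (content_monomial s) = (chains s setT)%:R%R.
Proof.
move=> RT AE; pose n := (size s).+1.
pose emb (g : {ffun F -> 'I_n}) : {ffun F -> nat} := [ffun z => val (g z)].
have emb_inj : injective emb.
  move=> g h /ffunP gh; apply/ffunP => c; apply/val_inj.
  by have := gh c; rewrite !ffunE.
rewrite -(@card_fillings n) // /generating_series.
pose r := [seq emb g | g <- enum (fillings n s setT)].
rewrite (_ : [set f | _]%classic = [set` r]%classic); last first.
  apply/seteqP; split => [t [/AE At tm]|t /mapP[g]].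
    have tE i : #|[set z | t z == i]| = nth 0 (rev s) i.
      by rewrite -fmonomialE tm content_monomialE.
    have t_lt z : t z < n.
      have : 0 < #|[set y | t y == t z]|.
        by apply/card_gt0P; exists z; rewrite inE.
      rewrite tE /n ltnS => h; rewrite leqNgt; apply/negP => ?.
      by rewrite nth_default ?size_rev // ltnW in h.
    have t_lt' z : t z < size s.
      have : 0 < #|[set y | t y == t z]|.
        by apply/card_gt0P; exists z; rewrite inE.
      rewrite tE => h; rewrite ltnNge; apply/negP => ?.
      by rewrite nth_default ?size_rev in h.
    apply/mapP; exists [ffun z => Ordinal (t_lt z)]; last first.
      by apply/ffunP => z; rewrite !ffunE.
    have bE j : below [ffun z => Ordinal (t_lt z)] j = [set c | t c < j].
      by apply/setP => c; rewrite !inE ffunE.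
    rewrite mem_enum inE; apply/and4P; split.
    - by apply/eqP/setP => c; rewrite !inE ffunE /= t_lt'.
    - by apply/forallP => c; rewrite ffunE /= ltnW.
    - by apply/forallP => j; rewrite !bE.
    - apply/forallP => j; rewrite -tE; apply/eqP/eq_card => c.
      by rewrite !inE ffunE.
  rewrite mem_enum inE => /and4P[/eqP gT gk /forallP gR /forallP gn] ->.
  have g_lt z : g z < size s.
    by have := in_setT z; rewrite -gT inE.
  have bE j : [set c | emb g c < j] = below g j.
    by apply/setP => c; rewrite !inE ffunE.
  have bT j : size s <= j -> below g j = setT.
    by move=> sj; apply/setP => c; rewrite !inE (leq_trans (g_lt c) sj).
  split => /=.
    apply/AE => k; rewrite !bE.
    have [ks|sk] := ltnP k (size s); first by have := gR (Ordinal ks).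
    by rewrite !bT //; exact: leqW.
  apply/eqP/cmP => i; rewrite fmonomialE content_monomialE.
  have [si|si] := ltnP i (size s).
    have /eqP <- := gn (Ordinal si).
    by apply/eq_card => c; rewrite !inE ffunE.
  rewrite nth_default ?size_rev //; apply/eqP; rewrite cards_eq0.
  apply/eqP/setP => c; rewrite !inE ffunE /=;
    by rewrite ltn_eqF // (leq_trans (g_lt c)).
have r_uniq : uniq r by rewrite map_inj_uniq ?enum_uniq.
rewrite -(fsbig_seq _ _ r_uniq).
by rewrite big_map big_enum /= sumr_const.
Qed.

End Chains.

(** * Linear forms in coefficients, and the pairing with e_a e_b *)

Section Functionals.
Local Open Scope ring_scope.

Definition coef_form (L : seq (rat * seq nat)) (f : fps) : rat :=
  \sum_(p <- L) p.1 * f (content_monomial p.2).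

Lemma coef_form_ge0 L f :
  schur_positive f -> (forall la, 0 <= coef_form L (schur la)) ->
  0 <= coef_form L f.
Proof.
move=> [c fE c0] L0.
have -> : coef_form L f = \sum_(la <- finsupp c) c la * coef_form L (schur la).
  under [RHS]eq_bigr do rewrite mulr_sumr.
  rewrite exchange_big /=; apply: eq_bigr => p _; rewrite fE mulr_sumr.
  by apply: eq_bigr => la _; rewrite mulrCA.
by apply: sumr_ge0 => la _; rewrite mulr_ge0.
Qed.

Fixpoint compositions (fuel n : nat) : seq (seq nat) :=
  if n == 0%N then [:: [::]] else
  if fuel is p.+1 then
    flatten [seq [seq g :: a | a <- compositions p (n - g)] | g <- iota 1 n]
  else [::].

(* The form f |-> <f, e_a e_b>, up to the sign (-1)^(a + b): e_a is the sum of
   (-1)^(a - length al) h_al over the compositions al of a, and <f, h_al> is the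
   coefficient of x^al in f. *)
Definition elementary_form (a b : nat) : seq (rat * seq nat) :=
  [seq ((-1) ^+ (size al + size be), al ++ be)
     | al <- compositions b b, be <- compositions a a].

Variables (F : finType) (R : rel {set F}) (V : {set F} -> {set F} -> nat).
Hypothesis V_refl : forall U, V U U = 1%N.
Hypothesis V_inv : forall U W : {set F}, U \proper W ->
  (V U W)%:R + \sum_(B : {set F} | [&& U \subset B, B \proper W & R B W])
     (-1) ^+ #|W :\: B| * (V U B)%:R = 0 :> rat.

(* The signed sum over all refinements of a step inverts, in the incidence
   algebra of sets, the function (-1)^#|W :\: B| R B W; [V_inv] says that V is
   that inverse. *)
Lemma signed_chains fuel b be W : (b <= fuel)%N ->
  \sum_(al <- compositions fuel b) (-1) ^+ size al * (chains R (al ++ be) W)%:R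
  = (-1) ^+ b * \sum_(U : {set F} | (U \subset W) && (#|W :\: U| == b))
      (V U W)%:R * (chains R be U)%:R :> rat.
Proof.
have base fuel' W' : \sum_(al <- compositions fuel' 0)
    (-1) ^+ size al * (chains R (al ++ be) W')%:R =
    (-1) ^+ 0 * \sum_(U : {set F} | (U \subset W') && (#|W' :\: U| == 0))
      (V U W')%:R * (chains R be U)%:R :> rat.
  rewrite (big_pred1 W') => [|U]; last first.
    by rewrite cards_eq0 setD_eq0 -eqEsubset.
  by rewrite V_refl; case: fuel' => [|?]; rewrite /= big_seq1 !mul1r.
elim: fuel b W => [|fuel IH] b W bf.
  by move: bf; rewrite leqn0 => /eqP ->; exact: base.
have [->|b0] := posnP b; first exact: base.
rewrite /= gtn_eqF // big_flatten big_map /=.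
(* The first part [g] is the size of the top step from [W] to [B]; the induction hypothesis handles
   the chain below [B]. *)
have E1 g : g \in iota 1 b ->
    \sum_(al <- [seq g :: a | a <- compositions fuel (b - g)])
      (-1) ^+ size al * (chains R (al ++ be) W)%:R =
    - (-1) ^+ b * \sum_(B : {set F} | [&& B \subset W, #|W :\: B| == g & R B W])
      (-1) ^+ #|W :\: B| *
      \sum_(U : {set F} | (U \subset B) && (#|B :\: U| == b - g)%N)
        (V U B)%:R * (chains R be U)%:R :> rat.
  rewrite mem_iota => /andP[g1 gb]; rewrite big_map /=.
  under eq_bigr do rewrite natr_sum mulr_sumr.
  rewrite exchange_big /= mulr_sumr; apply: eq_bigr => B /and3P[_ /eqP Bg _].
  under eq_bigr do rewrite exprS -mulrA.
  rewrite -mulr_sumr IH; last by lia.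
  rewrite !mulrA; congr (_ * _); rewrite Bg mulN1r mulNr -exprD; congr (- _).
  by rewrite -signr_odd -[RHS]signr_odd; congr (_ ^+ nat_of_bool _); lia.
rewrite (eq_big_seq _ E1) -mulr_sumr mulNr -mulrN; congr (_ * _).
pose G (B : {set F}) := (-1) ^+ #|W :\: B| *
  \sum_(U : {set F} | (U \subset B) && (#|B :\: U| == b - #|W :\: B|)%N)
    (V U B)%:R * (chains R be U)%:R :> rat.
transitivity (- \sum_(B : {set F} | [&& B \subset W,
  R B W & #|W :\: B| \in iota 1 b]) G B).
  congr (- _).
  transitivity (\sum_(g <- iota 1 b) \sum_(B : {set F} | (B \subset W) && R B W)
      (if g == #|W :\: B| then G B else 0)).
    apply: eq_bigr => g _; rewrite -big_mkcondr /=.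
    apply: eq_big => [B|B /and3P[_ /eqP <- _]] //.
    by rewrite -andbA [R B W && _]andbC eq_sym.
  rewrite exchange_big /= [RHS](eq_bigl (fun B : {set F} =>
    [&& B \subset W & R B W] &&
    (#|W :\: B| \in iota 1 b))); last by move=> B; rewrite andbA.
  rewrite [RHS]big_mkcondr /=; apply: eq_bigr => B _.
  rewrite -big_mkcond /=; case: ifPn => hB.
    by rewrite (big_rem _ hB) /= eqxx big1_seq ?addr0 // => g /andP[/eqP ->];
       rewrite mem_rem_uniqF ?iota_uniq.
  by rewrite big1_seq // => g /andP[/eqP -> ]; rewrite (negPf hB).
(* [V_inv] trades [V U W] for a sum over intermediate sets [B]; exchanging the sums over [U] and [B]
   then matches the two sides. *)
rewrite -sumrN [RHS](eq_bigr (fun U : {set F} =>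
  \sum_(B : {set F} | [&& U \subset B, B \proper W & R B W])
   - ((-1) ^+ #|W :\: B| * (V U B)%:R * (chains R be U)%:R))); last first.
  move=> U /andP[UW /eqP WU].
  have UpW : U \proper W.
    by rewrite properEcard UW -(cardsID U W) (setIidPr UW) WU; lia.
  move/eqP: (V_inv UpW); rewrite addr_eq0 => /eqP ->.
  by rewrite mulNr mulr_suml sumrN.
rewrite (exchange_big_dep (fun B : {set F} =>
  [&& B \subset W, R B W & #|W :\: B| \in iota 1 b])) /=; last first.
  move=> U B /andP[UW /eqP WU] /and3P[UB BW RB].
  rewrite (proper_sub BW) RB mem_iota /= add1n ltnS -WU.
  rewrite subset_leq_card ?setDS // andbT card_gt0 setD_eq0.
  by case/properP: BW => _ [x xW xB]; apply/fintype.subsetPn; exists x.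
apply: eq_bigr => B /and3P[BW RB]; rewrite mem_iota add1n ltnS => /andP[B1 Bb].
rewrite /G mulr_sumr -sumrN; apply: eq_big => [U|U _]; last by rewrite mulrA.
have BpW : B \proper W.
  by rewrite properEcard BW -(cardsID B W) (setIidPr BW); lia.
rewrite RB BpW !andbT /=; case UB: (U \subset B) => //=; last by rewrite andbF.
rewrite (fintype.subset_trans UB BW) /= andbT.
have cW := cardsID B W; have cW' := cardsID U W; have cB := cardsID U B.
rewrite !(setIidPr _) // ?(fintype.subset_trans UB BW) // in cW cW' cB.
apply/eqP/eqP; lia.
Qed.

(** [signed_chains] is applied twice: the parts [al] of the last letters lead from [setT] down to
    [U], and the parts [be] from [U] down to [set0], the only set that has an empty chain. *)
Lemma elementary_formE (A : set {ffun F -> nat}) a b :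
  R setT setT ->
  (forall t : {ffun F -> nat}, A t <->
     forall k, R [set c | (t c < k)%N] [set c | (t c < k.+1)%N]) ->
  coef_form (elementary_form a b) (generating_series A) =
  (-1) ^+ (a + b) * \sum_(U : {set F} | (#|U| == a) && (#|~: U| == b))
    (V set0 U * V U setT)%:R.
Proof.
move=> RT AE; rewrite /coef_form /elementary_form big_allpairs_dep /=.
have E al be : (-1) ^+ (size al + size be) *
    generating_series A (content_monomial (al ++ be)) =
    ((-1) ^+ size be) * ((-1) ^+ size al * (chains R (al ++ be) setT)%:R).
  by rewrite (generating_seriesE _ RT AE) exprD -mulrA mulrCA.
under eq_bigr => al _ do under eq_bigr => be _ do rewrite E.
rewrite exchange_big /=.
under eq_bigr => be _ do rewrite -mulr_sumr signed_chains // mulrCA mulr_sumr.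
rewrite -mulr_sumr exchange_big /= addnC exprD -mulrA; congr (_ * _).
rewrite mulr_sumr big_mkcond [RHS]big_mkcond; apply: eq_bigr => U _ /=.
rewrite subsetT setTD /= [_ && (_ == b)]andbC; case: eqP => //= _.
under eq_bigr => be _ do rewrite mulrCA -{2}[be]cats0.
rewrite -mulr_sumr signed_chains //.
rewrite (eq_bigr (fun U' => if U' == set0 then (V U' U)%:R else 0)); last first.
  by move=> U' _ /=; case: eqP => _; rewrite ?mulr1 ?mulr0.
rewrite -big_mkcondr /= (eq_bigl (fun U' => (#|U| == a) && (U' == set0)));
  last first.
  move=> U'; case: (U' =P set0) => [->|]; last by rewrite !andbF.
  by rewrite sub0set setD0 andbT.
case: eqP => _; last by rewrite big_pred0 ?mulr0.
by rewrite (big_pred1 set0) // natrM mulrCA [X in _ * X]mulrC.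
Qed.
End Functionals.

(** * Horizontal and vertical strips *)

Section TwoSteps.
Variables (F : finType) (R : rel {set F}).

Definition two_step (W : {set F}) (a : nat) : {set {set F}} :=
  [set U : {set F} | [&& U \subset W, #|U| == a, R set0 U & R U W]].

Lemma chains1 a W : chains R [:: a] W = (#|W| == a) && R set0 W :> nat.
Proof.
rewrite /= (eq_bigr (fun C => if C == set0 then 1 else 0)); last first.
  by move=> C _; case: eqP.
rewrite -big_mkcondr (eq_bigl (fun C =>
  (C == set0) && ((#|W| == a) && R set0 W))).
  case: (_ && R set0 W); last by rewrite big_pred0 // => C; rewrite andbF.
  by rewrite (big_pred1 set0) // => C; rewrite andbT.
move=> C; case: (C =P set0) => [->|]; last by rewrite andbF.
by rewrite sub0set setD0 andbT.
Qed.

Lemma chains2 a b W :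
  chains R [:: b; a] W = (#|W| == a + b) * #|two_step W a|.
Proof.
transitivity (\sum_(B : {set F} | [&& B \subset W, #|W :\: B| == b & R B W])
   ((#|B| == a) && R set0 B : nat)).
  by apply: eq_bigr => B _; exact: chains1.
rewrite -[#|two_step W a|]sum1_card big_distrr /= big_mkcond [RHS]big_mkcond.
apply: eq_bigr => U _; rewrite inE /=.
case: (boolP (U \subset W)) => //= UW.
rewrite -(cardsID U W) (setIidPr UW); move: #|U| #|W :\: U| => x y.
by case: (R U W); case: (R set0 U); case: (x =P a); case: (y =P b);
   case: (x + y =P a + b) => //=; lia.
Qed.
End TwoSteps.

Section Diagrams.
Variables (F : finType) (row col : F -> nat).
Implicit Types U W : {set F}.

Definition left_closed U :=
  [forall c, forall d, [&& row c == row d, col c <= col d & d \in U] ==>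
    (c \in U)].

Definition hstrip U W :=
  [&& left_closed U, left_closed W &
    [forall c, forall d, [&& col c == col d, row c < row d & d \in W] ==>
      (c \in U)]].

Lemma left_closedP U :
  reflect (forall c d, row c = row d -> col c <= col d -> d \in U -> c \in U)
          (left_closed U).
Proof.
apply: (iffP 'forall_'forall_implyP) => [H c d rcd ccd dU|H c d].
  by apply: (H c d); apply/and3P; split=> //; apply/eqP.
by case/and3P => /eqP; exact: H.
Qed.

Lemma hstripP U W :
  reflect [/\ left_closed U, left_closed W &
    forall c d, col c = col d -> row c < row d -> d \in W -> c \in U]
    (hstrip U W).
Proof.
apply: (iffP and3P) => -[UL WL H]; split => //.
  by move=> c d cd rcd dW; apply: (implyP (forallP (forallP H c) d));
    rewrite cd eqxx rcd.
by apply/'forall_'forall_implyP => c d /and3P[/eqP]; exact: H.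
Qed.

Lemma hstrip_below (t : {ffun F -> nat}) :
  (forall k, hstrip [set c | t c < k] [set c | t c < k.+1]) <->
  (forall c d, row c = row d -> col c <= col d -> t c <= t d) /\
  (forall c d, col c = col d -> row c < row d -> t c < t d).
Proof.
split=> [H|[H1 H2] k].
  split=> c d; have /hstripP[_ /left_closedP H1 H2] := H (t d).
    by move=> rcd ccd; have := H1 c d rcd ccd; rewrite !inE ltnSn ltnS; exact.
  by move=> ccd rcd; have := H2 c d ccd rcd; rewrite !inE ltnSn; exact.
apply/hstripP; split; try (apply/left_closedP => c d rcd ccd; rewrite !inE;
  exact/leq_ltn_trans/H1).
by move=> c d ccd rcd; rewrite !inE ltnS; apply/leq_trans/H2.
Qed.

Hypothesis cell_inj : forall c d, row c = row d -> col c = col d -> c = d.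
Hypothesis cell_down : forall d i j, i <= row d -> j <= col d ->
  exists2 c, row c = i & col c = j.

Lemma hstrip0_row U c : hstrip set0 U -> c \in U -> row c = 0.
Proof.
move=> /hstripP[_ _ H] cU; apply/eqP; rewrite -leqn0 leqNgt; apply/negP => r0.
have [d rd cd] := cell_down (leq0n (row c)) (leqnn (col c)).
by have := H d c cd; rewrite rd r0 cU inE => /(_ isT isT).
Qed.

Lemma hstrip0_nested U U' : hstrip set0 U -> hstrip set0 U' -> ~~ (U \subset
  U') ->
  U' \subset U.
Proof.
move=> hU hU' /subsetPn[c cU cU']; apply/fintype.subsetP => d dU'.
have [/hstripP[_ /left_closedP UL _] /hstripP[_ /left_closedP UL' _]] := (hU,
  hU').
have rcd : row c = row d by rewrite (hstrip0_row hU cU) (hstrip0_row hU' dU').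
case: (leqP (col c) (col d)) => [ccd|/ltnW dc].
  by rewrite (UL' c d) in cU'.
by apply: UL cU => //.
Qed.

(** The first letter fills an initial segment of row 0, so its set of cells is determined by its
    size. *)
Lemma two_step_le1 W a : #|two_step hstrip W a| <= 1.
Proof.
apply/card_le1_eqP => U U'; rewrite !inE.
move=> /and4P[_ /eqP aU hU _] /and4P[_ /eqP aU' hU' _]; apply/eqP.
have [UU'|/hstrip0_nested UU'] := boolP (U \subset U').
  by rewrite eq_sym eqEcard UU' aU aU' leqnn.
by rewrite eqEcard (UU' hU hU') aU aU' leqnn.
Qed.

(** If some cell [d] of [W] lay below the last cell [c0] of the first letter, then the row of [d],
    being closed to the left, would contain a cell of [W :\: U] under every cell of [U], and [W]
    would have at least twice as many cells as [U]. *)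
Lemma hstrip_last U W c0 : hstrip set0 U -> hstrip U W -> U \subset W ->
  #|W| < #|U|.*2 -> c0 \in U -> (forall c, c \in U -> col c <= col c0) ->
  hstrip set0 (U :\ c0) /\ hstrip (U :\ c0) W.
Proof.
move=> hU hUW UW Wlt c0U c0max.
have [/left_closedP UL /left_closedP WL H] := hstripP _ _ hUW.
have U'L : left_closed (U :\ c0).
  apply/left_closedP => c d rcd ccd; rewrite !inE => /andP[dc0 dU].
  rewrite (UL c d) // andbT; apply: contraNneq dc0 => cc0; apply/eqP/cell_inj.
    by rewrite -cc0.
  by apply/eqP; rewrite eqn_leq c0max //= -cc0.
have [/hstripP[h0 _ H0]] := hU.
split; apply/hstripP; split => //; first by move=> c d ? ?;
  rewrite inE => /andP[_]; exact: H0.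
  exact/left_closedP.
move=> c d ccd rcd dW; rewrite !inE (H c d) // andbT.
apply/negP => /eqP cc0; move: Wlt; apply/negP; rewrite -leqNgt -addnn.
have rd : 0 < row d by apply: leq_ltn_trans rcd.
have ex c' : c' \in U -> exists2 e, e \in W :\: U & col e = col c'.
  move=> c'U; have [e re ce] : exists2 e, row e = row d & col e = col c'.
    by apply: (@cell_down d) => //; rewrite -ccd cc0 c0max.
  exists e => //; rewrite inE (WL e d) ?re // ?andbT ?ce -?ccd ?cc0 ?c0max //.
  by apply/negP => /(hstrip0_row hU); rewrite re; lia.
rewrite -(cardsID U W) (setIidPr UW) leq_add2l.
pose f c' := odflt c' [pick e in W :\: U | col e == col c'].
have fP c' : c' \in U -> (f c' \in W :\: U) && (col (f c') == col c').
  move=> c'U; rewrite /f; case: pickP => //= H'.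
  by have [e eW ce] := ex _ c'U; have := H' e; rewrite eW ce eqxx.
rewrite -(@card_in_imset _ _ f (mem U)); last first.
  move=> x y xU yU fxy; apply: cell_inj.
    by rewrite (hstrip0_row hU xU) (hstrip0_row hU yU).
  have /andP[_ /eqP <-] := fP _ xU; have /andP[_ /eqP <-] := fP _ yU.
  by rewrite fxy.
by apply/subset_leq_card/fintype.subsetP => _ /imsetP[x xU ->];
  case/andP: (fP _ xU).
Qed.

(** Turning the last occurrence of the first letter into the second letter lowers [a] by one. The
    bound on [W] makes [hstrip_last] available all the way down to [k]. *)
Lemma two_step_mono W a k : k <= a -> #|W| <= k.*2.+1 ->
  #|two_step hstrip W a| <= #|two_step hstrip W k|.
Proof.
move=> ka Wk; elim: a ka => [|a IH]; first by rewrite leqn0 => /eqP ->.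
rewrite leq_eqVlt => /orP[/eqP -> //|]; rewrite ltnS => ka.
apply: leq_trans (IH ka).
have [->|[U]] := set_0Vmem (two_step hstrip W a.+1); first by rewrite cards0.
rewrite inE => /and4P[UW /eqP aU hU hUW].
apply: leq_trans (two_step_le1 _ _) _; rewrite card_gt0; apply/set0Pn.
have [u uU] : exists u, u \in U by apply/set0Pn; rewrite -card_gt0 aU.
case: (@arg_maxnP _ u (mem U) col uU) => c0 c0U c0max.
have [|h1 h2] := hstrip_last hU hUW UW _ c0U c0max; first by rewrite aU; lia.
exists (U :\ c0); rewrite inE h1 h2 (fintype.subset_trans _ UW) ?subsetDl //=.
by have := cardsD1 c0 U; rewrite (c0U : c0 \in U) aU; lia.
Qed.
End Diagrams.

(** Toggling [c0] is an involution on the sets satisfying [P] and flips every sign, so the sum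
    equals its own negative. *)
Lemma signed_sum_toggle (F : finType) (W : {set F}) (c0 : F)
  (P : pred {set F}) :
  c0 \in W -> (forall B, P B -> B \subset W) ->
  (forall B, P B -> c0 \in B -> P (B :\ c0)) ->
  (forall B, P B -> c0 \notin B -> P (c0 |: B)) ->
  (\sum_(B | P B) (-1) ^+ #|W :\: B| = 0 :> rat)%R.
Proof.
move=> c0W PW PD PU.
pose h (B : {set F}) := if c0 \in B then B :\ c0 else c0 |: B.
have hK : involutive h.
  move=> B; rewrite /h; case: (boolP (c0 \in B)) => cB.
    by rewrite setD11 setD1K.
  by rewrite setU11 setU1K.
have hP B : P B -> P (h B) by rewrite /h => PB; case: ifPn => ?; auto.
set S := (\sum_(_ | _) _)%R; suff: (S = - S)%R by lra.
rewrite {1}/S (reindex_inj (inv_inj hK)) /= -sumrN; apply: eq_big => B.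
  by apply/idP/idP => /hP //; rewrite hK.
move=> /hP; rewrite hK => PB.
have cardE (C : {set F}) : c0 \notin C -> #|W :\: C| = #|W :\: (c0 |: C)|.+1.
  move=> cC; rewrite (cardsD1 c0) inE cC c0W add1n; congr _.+1.
  by apply: eq_card => x; rewrite !inE negb_or andbA.
rewrite /h; case: ifPn => cB.
  by rewrite cardE ?setD11 // setD1K // exprS mulN1r.
by rewrite (cardE B) // exprS mulN1r opprK.
Qed.

(** * Vertical strips invert horizontal strips *)

Section StripInverse.
Variables (F : finType) (row col : F -> nat).
Implicit Types U W : {set F}.
Hypothesis cell_inj : forall c d, row c = row d -> col c = col d -> c = d.

(** A vertical strip is a horizontal strip with rows and columns exchanged. The diagonal is added
    because the inverse must take the value 1 at every pair (U, U), whereas [hstrip col row U U]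
    fails when [U] is not a diagram. *)
Definition vstrip_or_eq U W : nat := (U == W) || hstrip col row U W.

(* The terms cancel in pairs: adding or removing the first cell of the lowest
   row of W :\: U preserves both strip conditions. *)
Lemma vstrip_or_eq_inv U W : U \proper W ->
  ((vstrip_or_eq U W)%:R +
   \sum_(B : {set F} | [&& U \subset B, B \proper W & hstrip row col B W])
     (-1) ^+ #|W :\: B| * (vstrip_or_eq U B)%:R = 0 :> rat)%R.
Proof.
move=> UpW; have UW := proper_sub UpW.
have UneqW : U != W by move: UpW; rewrite properEneq => /andP[].
(* If [W] is not itself a diagram, no [B] is a horizontal strip below it and [U] is not a vertical
   strip below it, so every term vanishes. *)
have [RW|RW] := boolP (hstrip row col W W); last first.
  rewrite big_pred0 ?addr0; last first.
    move=> B; apply: contraNF RW => /and3P[_ BW /hstripP[_ WL H]].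
    apply/hstripP; split => // c d ccd rcd dW.
    by apply: (fintype.subsetP (proper_sub BW)); exact: H dW.
  rewrite /vstrip_or_eq (negPf UneqW) /=;
    case: hstripP => //= -[_ /left_closedP WL H].
  case/negP: RW; apply/hstripP; split;
    try (apply/left_closedP => c d rcd ccd dW).
  - move: ccd; rewrite leq_eqVlt => /orP[/eqP ccd|ccd];
    first by rewrite (cell_inj rcd ccd).
    by apply: (fintype.subsetP UW); exact: H dW.
  - move: ccd; rewrite leq_eqVlt => /orP[/eqP ccd|ccd];
    first by rewrite (cell_inj rcd ccd).
    by apply: (fintype.subsetP UW); exact: H dW.
  - by move=> c d ccd rcd; apply: WL => //; exact: ltnW.
have [/left_closedP WL _ WC] := hstripP _ _ _ _ RW.
(* The separate term [vstrip_or_eq U W] is the missing summand [B = W], and on this range the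
   diagonal value agrees with the strip condition, so a single signed sum remains. *)
pose P (B : {set F}) :=
  [&& U \subset B, B \subset W, hstrip row col B W & hstrip col row U B].
transitivity (\sum_(B | P B) (-1) ^+ #|W :\: B| : rat)%R.
  have VE (B : {set F}) : U \subset B -> B \subset W -> hstrip row col B W ->
      vstrip_or_eq U B = hstrip col row U B.
    rewrite /vstrip_or_eq; case: (U =P B) => //= <- _ {}BW /hstripP[UL _ H].
    suff -> : hstrip col row U U by []. apply/hstripP; split.
    - apply/left_closedP => c d ccd; rewrite leq_eqVlt => /orP[/eqP rcd|rcd] dU.
        by rewrite (cell_inj rcd ccd).
      by apply: H ccd rcd _; exact: (fintype.subsetP UW).
    - apply/left_closedP => c d ccd; rewrite leq_eqVlt => /orP[/eqP rcd|rcd] dU.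
        by rewrite (cell_inj rcd ccd).
      by apply: H ccd rcd _; exact: (fintype.subsetP UW).
    - by move=> c d rcd /ltnW ccd; move/left_closedP: UL; exact.
  rewrite /P [RHS](eq_bigl (fun B : {set F} =>
    [&& U \subset B, B \subset W & hstrip row col B W]
     && hstrip col row U B)); last by move=> B; rewrite !andbA.
  rewrite [RHS]big_mkcondr [RHS](bigD1 W) /=; last by rewrite UW subxx RW.
  rewrite setDv cards0 expr0 VE //; congr (_ + _)%R; first by case: hstrip.
  apply: eq_big => B; first
    by rewrite properEneq; case: (U \subset B); case: (B != W);
       case: (B \subset W); case: hstrip.
  move=> /and3P[UB /proper_sub BW RB]; rewrite VE //.
  by case: hstrip; rewrite ?mulr1 ?mulr0.
have [u uWU] : exists u, u \in W :\: U.
  by case/properP: UpW => _ [x xW xU]; exists x; rewrite inE xU.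
case: (@arg_maxnP _ u (mem (W :\: U)) row uWU) => u1 u1D u1max.
case: (@arg_minnP _ u1 (fun c => (c \in W :\: U) && (row c == row u1)) col).
  by rewrite eqxx andbT.
move=> c0 /andP[c0D /eqP rc0] c0min.
have {u1max} c0max c : c \in W :\: U -> row c <= row c0.
  by move=> cD; rewrite rc0; exact: u1max.
have {}c0min c : c \in W :\: U -> row c = row c0 -> col c0 <= col c.
  by move=> cD rc; apply: c0min; rewrite cD rc rc0 eqxx.
move: c0D; rewrite inE => /andP[c0U c0W].
have rowlt c : c \in W -> col c = col c0 -> row c0 < row c -> c \in U.
  move=> cW _ rc; apply/negPn/negP => cU; move: rc; rewrite ltnNge c0max //.
  by rewrite inE cU.
apply: (signed_sum_toggle c0W) => B /and4P[UB BW RB VB] //; move=> c0B.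
- have [/left_closedP BL _ BC] := hstripP _ _ _ _ RB.
  have [/left_closedP UC /left_closedP BC' UV] := hstripP _ _ _ _ VB.
  apply/and4P; split.
  + by apply/fintype.subsetP => x xU;
    rewrite !inE (fintype.subsetP UB) // andbT;
      apply: contraNneq c0U => <-.
  + exact: fintype.subset_trans (subsetDl _ _) BW.
  + apply/hstripP; split; [|exact/left_closedP|].
      apply/left_closedP => c d rcd ccd; rewrite !inE => /andP[dc0 dB].
      rewrite (BL c d) // andbT; apply: contraNneq c0U => cc0; subst c.
      apply: UV dB => //; rewrite ltn_neqAle ccd andbT.
      by apply: contraNneq dc0 => ccd'; apply/eqP/cell_inj.
    move=> c d ccd rcd dW; rewrite !inE (BC c d) // andbT.
    apply: contraNneq c0U => cc0; subst c.
    by apply: (UC c0 d) => //; [exact: ltnW | apply: rowlt].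
  + apply/hstripP; split; [exact/left_closedP| |].
      apply/left_closedP => c d ccd rcd; rewrite !inE => /andP[dc0 dB].
      rewrite (BC' c d) // andbT; apply: contraNneq c0U => cc0; subst c.
      apply: (UC c0 d) => //; apply: rowlt => //;
        first exact: (fintype.subsetP BW).
      rewrite ltn_neqAle rcd andbT.
      by apply: contraNneq dc0 => rcd'; apply/eqP/cell_inj.
    by move=> c d rcd ccd; rewrite !inE => /andP[_]; exact: UV.
- have [/left_closedP BL _ BC] := hstripP _ _ _ _ RB.
  have [/left_closedP UC /left_closedP BC' UV] := hstripP _ _ _ _ VB.
  have leftU c : row c = row c0 -> col c < col c0 -> c \in U.
    move=> rc cc; apply/negPn/negP => cU; have := cc; rewrite ltnNge c0min //.
    by rewrite inE cU; exact: WL rc (ltnW cc) c0W.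
  apply/and4P; split.
  + exact: fintype.subset_trans UB (subsetUr _ _).
  + by rewrite subUset sub1set c0W.
  + apply/hstripP; split; [|exact/left_closedP|].
      apply/left_closedP => c d rcd ccd; rewrite !inE => /orP[/eqP dc0|dB].
        subst d; move: ccd; rewrite leq_eqVlt => /orP[/eqP ccd|ccd].
          by rewrite (cell_inj rcd ccd) eqxx.
        by rewrite (fintype.subsetP UB) ?orbT //; exact: leftU.
      by rewrite (BL c d) ?orbT.
    by move=> c d ccd rcd dW; rewrite inE (BC c d) ?orbT.
  + apply/hstripP; split; [exact/left_closedP| |].
      apply/left_closedP => c d ccd rcd; rewrite !inE => /orP[/eqP dc0|dB].
        subst d; move: rcd; rewrite leq_eqVlt => /orP[/eqP rcd|rcd].
          by rewrite (cell_inj rcd ccd) eqxx.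
        by rewrite (BC c c0) ?orbT.
      by rewrite (BC' c d) ?orbT.
    move=> c d rcd ccd; rewrite !inE => /orP[/eqP dc0|dB]; last exact: UV dB.
    by subst d; exact: leftU.
Qed.
End StripInverse.

(** * Tableaux behind the three-part inequality *)

Section ThreeRows.
Variables (F : finType) (row col : F -> nat).
Implicit Types U W : {set F}.
Hypothesis cell_inj : forall c d, row c = row d -> col c = col d -> c = d.
Hypothesis cell_down : forall d i j, i <= row d -> j <= col d ->
  exists2 c, row c = i & col c = j.

Let hs := hstrip row col.
Let lc := left_closed row col.
Let Z := [set c | row c == 0].

Lemma hstrip_subr U W W' : W' \subset W -> lc W' -> hs U W -> hs U W'.
Proof.
move=> W'W W'L /hstripP[UL _ H]; apply/hstripP; split => // c d ccd rcd dW'.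
by apply: (H c d) => //; exact: (fintype.subsetP W'W).
Qed.

Lemma left_closedT : lc setT.
Proof. by apply/left_closedP => *; rewrite inE. Qed.

Lemma hstrip0_row0 : hs set0 Z.
Proof.
apply/hstripP; split; try apply/left_closedP => c d rcd _; rewrite ?inE //.
  by rewrite rcd.
by move=> c d _; rewrite !inE => /[swap] /eqP ->.
Qed.

(** If two letters suffice, there are at most two rows, and the first letter may fill the whole of
    row 0. *)
Lemma two_step_row0 U : hs set0 U -> hs U setT -> Z \in two_step hs setT #|Z|.
Proof.
move=> hU /hstripP[_ _ H]; rewrite inE subsetT eqxx hstrip0_row0 /=.
apply/hstripP; split; [by case/hstripP: hstrip0_row0|exact: left_closedT|].
by move=> c d ccd rcd _; rewrite inE (hstrip0_row cell_down hU) // (H c d) ?inE.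
Qed.

Lemma two_step_small W a : #|Z :&: W| < a -> #|two_step hs W a| = 0.
Proof.
move=> Zlt; apply/eqP; rewrite cards_eq0; apply/eqP/setP => U; rewrite !inE.
apply/negP => /and4P[UW /eqP aU hU _]; move: Zlt; rewrite ltnNge => /negP;
  apply.
rewrite -aU subset_leq_card // subsetI UW andbT.
by apply/fintype.subsetP => c cU; rewrite inE (hstrip0_row cell_down hU).
Qed.

(* Removing a corner so that the first row keeps exactly k + 2 cells. *)
Lemma removable_corner k U : #|F| = k.*2.+4 -> U \in two_step hs setT k.+2 ->
  #|two_step hs setT k.+4| = 0 ->
  exists W, [/\ #|setT :\: W| = 1, hs W setT, #|two_step hs W k.+2| = 1 &
    #|two_step hs W k.+3| = 0].
Proof.
move=> Fk; rewrite inE => /and4P[_ /eqP kU hU hUT] no4.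
have UZ : U \subset Z.
  by apply/fintype.subsetP => c cU; rewrite inE (hstrip0_row cell_down hU).
(* The shape is (k+2, k+2) or (k+3, k+1): row 0 contains [U], and k+4 cells or more in it would
   contradict [no4]. *)
have Zk2 : k.+2 <= #|Z| by rewrite -kU subset_leq_card.
have ZT := two_step_row0 hU hUT.
have Zk3 : #|Z| <= k.+3.
  rewrite leqNgt; apply/negP => Zk4.
  have := @two_step_mono F row col cell_inj cell_down setT _ k.+4 Zk4.
  rewrite cardsT Fk -/hs no4 leqn0 => /(_ _)/eqP/cards0_eq Z0;
    rewrite Z0 ?inE // in ZT.
  by lia.
have hZT : hs Z setT by move: ZT; rewrite inE => /and4P[].
have cardW c0 : #|setT :\: (setT :\ c0)| = 1.
  by rewrite setTD setCD setCT set0U cards1.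
suff [c0 [h1 h2 h3]] : exists c0, [/\ hs (setT :\ c0) setT,
    exists2 U1, U1 \in two_step hs setT k.+2 & c0 \notin U1 & #|Z :&: (setT :\
      c0)| < k.+3].
  exists (setT :\ c0); split => //; last exact: two_step_small.
  apply/eqP; rewrite eqn_leq card_gt0; apply/andP; split.
    exact: (two_step_le1 cell_down).
  apply/set0Pn.
  have [U1 + c0U1] := h2; rewrite inE => /and4P[_ kU1 hU1 hU1T].
  exists U1; rewrite inE kU1 hU1 subsetD1 subsetT c0U1 /=.
  apply: hstrip_subr hU1T; first exact: subsetT.
  by case/hstripP: h1.
(* With k+3 cells in row 0, the corner is the last cell of that row. *)
move: Zk3; rewrite leq_eqVlt => /orP[/eqP Zk3|].
  have [u uZ] : exists u, u \in Z by apply/set0Pn; rewrite -card_gt0 Zk3.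
  case: (@arg_maxnP _ u (mem Z) col uZ) => c0 c0Z c0max; exists c0.
  have [|h1 h2] := hstrip_last cell_inj cell_down hstrip0_row0 hZT (subsetT _)
    _ c0Z c0max.
    by rewrite cardsT Fk Zk3; lia.
  have cZ : #|Z :\ c0| = k.+2.
    by have := cardsD1 c0 Z; rewrite (c0Z : c0 \in Z) Zk3; lia.
  split; last by rewrite setIDA setIT cZ.
    apply/hstripP; split; [|exact: left_closedT|].
      apply/left_closedP => c d rcd ccd; rewrite !inE !andbT => dc0.
      apply: contraNneq dc0 => cc0; subst c; apply/eqP/cell_inj => //.
      apply/eqP; rewrite eqn_leq ccd andbT; apply: c0max.
      by move: (c0Z : c0 \in Z); rewrite !inE rcd.
    move=> c d ccd rcd dT; rewrite !inE andbT.
    by have /hstripP[_ _ /(_ c d ccd rcd dT)] := h2; rewrite !inE => /andP[].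
  exists (Z :\ c0); rewrite ?setD11 // inE subsetT cZ eqxx /=.
  exact/andP.
rewrite ltnS => Zk2'; have {Zk2 Zk2'} Zk2 : #|Z| = k.+2 by apply/eqP;
  rewrite eqn_leq Zk2'.
have [u uZ] : exists u, u \in ~: Z.
  by apply/set0Pn; rewrite -card_gt0; have := cardsC Z; rewrite Fk Zk2; lia.
(* With k+2 cells in row 0, the corner is the last cell of the lowest row, which is not row 0. *)
case: (@arg_maxnP _ u (mem (~: Z)) row uZ) => u1 u1D u1max.
case: (@arg_maxnP _ u1 (fun c => (c \in ~: Z) && (row c == row u1)) col).
  by rewrite eqxx andbT.
move=> c0 /andP[c0Z /eqP rc0] c0max; exists c0; split.
- apply/hstripP; split; [|exact: left_closedT|].
    apply/left_closedP => c d rcd ccd; rewrite !inE !andbT => dc0.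
    apply: contraNneq dc0 => cc0; subst c; apply/eqP/cell_inj => //.
    apply/eqP; rewrite eqn_leq ccd andbT; apply: c0max.
    by move: c0Z; rewrite !inE -rcd rc0 eqxx andbT.
  move=> c d ccd rcd _; rewrite !inE andbT; apply: contraTneq rcd => cc0;
    subst c.
  rewrite -leqNgt; have [->//|d0] := posnP (row d).
  by rewrite rc0; apply: u1max; rewrite !inE -lt0n.
- exists Z; last by move: c0Z; rewrite inE.
  by rewrite -Zk2.
- by rewrite ltnS -Zk2 subset_leq_card // subsetIl.
Qed.

(** Removing the one cell of the third letter turns a three-letter count into a sum over corners,
    which [two_step_mono] compares term by term. Only a shape that admits the content (k+2, k+2) but
    not (k+4, k) needs more, and there [removable_corner] gives a corner where the comparison is
    strict. *)
Lemma chains_three_rows k :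
  chains hs [:: 1; k; k.+3] setT + chains hs [:: k.+2; k.+2] setT <=
  chains hs [:: 1; k.+1; k.+2] setT + chains hs [:: k; k.+4] setT.
Proof.
rewrite !chains2 cardsT.
have E a b : chains hs [:: 1; b; a] setT = \sum_(W : {set F} |
    (#|setT :\: W| == 1) && hs W setT) (#|F| == a + b + 1) * #|two_step hs W a|.
  rewrite [LHS]/(chains hs (1 :: [:: b; a]) setT) [LHS]/=.
  apply: eq_big => W; first by rewrite subsetT.
  rewrite subsetT /= => /andP[/eqP W1 _].
  rewrite -[LHS]/(chains hs [:: b; a] W) chains2; congr (nat_of_bool _ * _).
  by rewrite -cardsT -(cardsID W setT) setTI W1 eqn_add2r.
rewrite !E.
have [Fk|Fk] := eqVneq #|F| k.*2.+4; last first.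
  by rewrite !big1 ?(negPf Fk) => *; case: eqP => // *; lia.
have -> : (#|F| == k.+3 + k + 1) by rewrite Fk; lia.
have -> : (#|F| == k.+2 + k.+1 + 1) by rewrite Fk; lia.
have -> : (#|F| == k.+2 + k.+2) by rewrite Fk; lia.
have -> : (#|F| == k.+4 + k) by rewrite Fk; lia.
rewrite !mul1n.
have le_W (W : {set F}) : #|setT :\: W| = 1 ->
    1 * #|two_step hs W k.+3| <= 1 * #|two_step hs W k.+2|.
  move=> W1; rewrite !mul1n; apply: two_step_mono => //.
  by have := cardsID W setT; rewrite cardsT Fk W1 setTI; lia.
have [->|[U kU]] := set_0Vmem (two_step hs setT k.+2).
  rewrite cards0 addn0; apply: leq_trans (leq_addr _ _).
  by apply: leq_sum => W /andP[/eqP /le_W].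
have le1 : #|two_step hs setT k.+2| <= 1 by exact: two_step_le1.
have [no4|/leq_trans le4] := posnP #|two_step hs setT k.+4|; last first.
  apply: leq_add; last exact/(leq_trans le1)/le4.
  by apply: leq_sum => W /andP[/eqP /le_W].
have [W [W1 hW W2 W3]] := removable_corner Fk kU no4.
rewrite no4 addn0 (bigD1 W) ?W1 //= [X in _ <= X](bigD1 W)
  ?W1 //= W2 W3 muln0 add0n mul1n addnC.
by apply: leq_add => //; apply: leq_sum => V /andP[/andP[/eqP /le_W]].
Qed.

(** Positive [a] and [b] keep [U] away from [set0] and [setT], so the added diagonal contributes
    nothing and two-letter tableaux of the transposed shape are counted. *)
Lemma strip_sum a b : 0 < a -> 0 < b ->
  \sum_(U : {set F} | (#|U| == a) && (#|~: U| == b))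
    vstrip_or_eq row col set0 U * vstrip_or_eq row col U setT =
  (#|F| == a + b) * #|two_step (hstrip col row) setT a|.
Proof.
move=> a0 b0; rewrite -[#|two_step _ _ _|]sum1_card big_distrr /=.
rewrite big_mkcond [RHS]big_mkcond; apply: eq_bigr => U _;
  rewrite inE subsetT /=.
rewrite -(cardsC U) /vstrip_or_eq.
case: eqP => //= aU; rewrite aU eqn_add2l; case: eqP => [bU|_];
  last by case: ifP.
have -> : (set0 == U) = false by apply/negP => /eqP U0;
  rewrite -U0 cards0 in aU; lia.
have -> : (U == setT) = false.
  by apply/negP => /eqP U0; rewrite U0 setCT cards0 in bU; lia.
by case: (hstrip _ _ set0 U); case: hstrip.
Qed.
End ThreeRows.

(** * Inequalities satisfied by Schur functions *)

Section SchurInequalities.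

Lemma cell_inj (la : Defs.partition) (c d : cell la) :
  cell_row c = cell_row d -> cell_col c = cell_col d -> c = d.
Proof.
case: c d => [i x] [j y]; rewrite /cell_row /cell_col /= => /val_inj ij.
by subst j => /val_inj ->.
Qed.

Lemma cell_down (la : Defs.partition) (d : cell la) i j :
  i <= cell_row d -> j <= cell_col d ->
  exists2 c : cell la, cell_row c = i & cell_col c = j.
Proof.
case: la d => la laP [p q] /=; rewrite /cell_row /cell_col /= => ip jq.
have lti : i < size la by apply: leq_ltn_trans (ltn_ord p).
have ltj : j < nth 0 la i.
  apply: leq_ltn_trans jq _; apply: leq_trans (ltn_ord q) _ => /=.
  have /andP[srt _] := laP.
  apply: (sorted_leq_nth _ _ 0 srt i p); rewrite ?inE //.
  - by move=> x y z /=; rewrite /geq => yx xz; apply: leq_trans xz yx.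
  - exact: leqnn.
by exists (@Tagged 'I_(size la) (Ordinal lti) (fun k =>
  'I_(nth 0 la k)) (Ordinal ltj)).
Qed.

Definition cell_hstrip (la : Defs.partition) := hstrip (@cell_row la)
  (@cell_col la).

Lemma cell_hstripT la : cell_hstrip [set: cell la] setT.
Proof. by apply/hstripP; split; try apply/left_closedP => *; rewrite ?inE. Qed.

Lemma semistandard_below la (t : {ffun cell la -> nat}) :
  [set t | @semistandard la t]%classic t <->
  forall k, cell_hstrip [set c | t c < k] [set c | t c < k.+1].
Proof. exact: (iff_sym (hstrip_below _ _ t)). Qed.

Lemma schur_chains la s :
  schur la (content_monomial s) = (chains (@cell_hstrip la) s setT)%:R%R.
Proof.
exact: generating_seriesE (cell_hstripT la) (@semistandard_below la).
Qed.

Local Open Scope ring_scope.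

Lemma schur_positive_two_rows f k a b :
  schur_positive f -> (a + b = k.*2)%N -> (k <= a)%N ->
  f (content_monomial [:: b; a]) <= f (content_monomial [:: k; k]).
Proof.
move=> fpos abk ka.
have := @coef_form_ge0 [:: (1, [:: k; k]); (-1, [:: b; a])] f fpos.
rewrite /coef_form !big_cons !big_nil /= => H.
suff: 0 <= 1 * f (content_monomial [:: k;
  k]) + (-1 * f (content_monomial [:: b; a]) + 0) by lra.
apply: H => la; rewrite !big_cons !big_nil /= !schur_chains !chains2.
rewrite mul1r mulN1r addr0 subr_ge0 ler_nat cardsT abk -addnn.
case: (#|_| =P _) => [cardF|_]; rewrite ?mul0n // !mul1n;
  apply: two_step_mono => //; [exact: cell_inj|exact: cell_down|].
by rewrite cardsT cardF; lia.
Qed.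

Lemma schur_positive_three_rows f k : schur_positive f ->
  f (content_monomial [:: 1; k; k.+3]%N) + f (content_monomial [:: k.+2;
    k.+2]) <=
  f (content_monomial [:: 1; k.+1; k.+2]%N) + f (content_monomial [:: k; k.+4]).
Proof.
move=> fpos.
have := @coef_form_ge0 [:: (1, [:: 1; k.+1; k.+2]%N); (1, [:: k; k.+4]);
  (-1, [:: 1; k; k.+3]%N); (-1, [:: k.+2; k.+2])] f fpos.
rewrite /coef_form !big_cons !big_nil => H; rewrite -subr_ge0.
move: H; rewrite [X in _ -> 0 <= X](_ : _ = 1 * f (content_monomial [:: 1;
  k.+1; k.+2]%N) +
  (1 * f (content_monomial [:: k; k.+4]) + (-1 * f (content_monomial [:: 1; k;
    k.+3]%N) +
  (-1 * f (content_monomial [:: k.+2; k.+2]) + 0)))); last by ring.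
apply => la; rewrite !big_cons !big_nil !schur_chains.
have := chains_three_rows (@cell_inj la) (@cell_down la) k.
rewrite -/(cell_hstrip _) -(ler_nat rat) !natrD.
by rewrite !mul1r !mulN1r addr0 addrA -opprD subr_ge0.
Qed.

Lemma coef_form_elementary_schur la a b : (0 < a)%N -> (0 < b)%N ->
  coef_form (elementary_form a b) (schur la) =
  (-1) ^+ (a + b) * ((#|cell la| == a + b)%N *
    #|two_step (hstrip (@cell_col la) (@cell_row la)) setT a|)%:R.
Proof.
move=> a0 b0; rewrite -strip_sum // natr_sum.
rewrite (elementary_formE _ (vstrip_or_eq_inv (@cell_inj la))
  _ _ (cell_hstripT la)
  (@semistandard_below la)) //.
by move=> U; rewrite /vstrip_or_eq eqxx.
Qed.

(** Both total degrees are 2k+4, so the signs are +1, and what remains is [two_step_mono] for the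
    transposed diagram. *)
Lemma schur_positive_two_columns f k : schur_positive f ->
  coef_form (elementary_form k.+3 k.+1)
    f <= coef_form (elementary_form k.+2 k.+2) f.
Proof.
move=> fpos; rewrite -subr_ge0.
have subE g : coef_form (elementary_form k.+2 k.+2)
  g - coef_form (elementary_form k.+3 k.+1) g
  = coef_form (elementary_form k.+2 k.+2 ++
      [seq (- p.1, p.2) | p <- elementary_form k.+3 k.+1]) g.
  rewrite /coef_form big_cat big_map /= -sumrN; congr (_ + _).
  by apply: eq_bigr => p _; rewrite mulNr.
rewrite subE; apply: coef_form_ge0 => // la; rewrite -subE.
rewrite !coef_form_elementary_schur //.
have -> : (k.+3 + k.+1 = k.+2 + k.+2)%N by lia.
rewrite addnn -signr_odd odd_double mul1r mul1r subr_ge0 ler_nat.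
case: (#|_| =P _) => [cardF|_]; rewrite ?mul0n // !mul1n;
  apply: two_step_mono => //.
- by move=> c d rcd ccd; exact: cell_inj.
- by move=> d i j id jd; have [c ? ?] := cell_down jd id; exists c.
- by rewrite cardsT cardF; lia.
Qed.
End SchurInequalities.

(** * The chromatic side *)

Section Forests.
Variable G : sgraph.
Implicit Types (x y z : G) (D : {set G}).
Hypothesis G_acyclic : acyclic G.

Definition stable (S : {set G}) :=
  [forall x, forall y, (x \in S) && (y \in S) ==> ~~ adj x y].

Lemma stableP (S : {set G}) :
  reflect (forall x y, x \in S -> y \in S -> ~~ adj x y) (stable S).
Proof.
apply: (iffP 'forall_'forall_implyP) => H x y; last by case/andP; exact: H.
by move=> xS yS; apply: H; rewrite xS.
Qed.

Definition stable_step (U W : {set G}) := stable (W :\: U).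

(** Otherwise every vertex of [D] has two neighbours in [D], and a path without repetition could be
    extended beyond the number of vertices, since running back into itself would close a cycle. *)
Lemma acyclic_leaf D : D != set0 ->
  exists2 x, x \in D &
    forall y z, y \in D -> z \in D -> adj x y -> adj x z -> y = z.
Proof.
move=> /set0Pn[d dD].
pose leaf x := [forall y, forall z,
  [&& y \in D, z \in D, adj x y & adj x z] ==> (y == z)].
have [x /andP[xD /'forall_'forall_implyP xleaf]|no_leaf] :=
    pickP (fun x => (x \in D) && leaf x).
  by exists x => // y z yD zD xy xz; apply/eqP/xleaf; rewrite yD zD xy.
have long n : exists x s, [/\ size s = n, path (@adj G) x s, uniq (x :: s) &
    {subset x :: s <= D}].
  elim: n => [|n [x [s [sz xs us sD]]]].
    by exists d, [::]; split => // x; rewrite inE => /eqP ->.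
  have xD : x \in D by apply: sD; rewrite mem_head.
  (* [head x s] is the predecessor of [x] on the path; any other neighbour lying on the path would
     close a cycle of more than two vertices. For empty [s] the default [x] excludes no neighbour,
     as [adj] is irreflexive. *)
  have [y yD [xy yhead]] : exists2 y, y \in D & adj x y /\ y != head x s.
    move: (no_leaf x); rewrite xD /= => /negbT.
    case/forallPn => y /forallPn[z];
      rewrite negb_imply => /andP[/and4P[yD zD xy xz] yz].
    have [yh|yh] := eqVneq y (head x s); last by exists y.
    by exists z => //; split => //; rewrite -yh eq_sym.
  have xNy : y != x by apply: contraTneq xy => ->; rewrite adj_irr.
  exists y, (x :: s); split.
  - by rewrite /= sz.
  - by rewrite /= adj_sym xy.
  - rewrite cons_uniq us andbT inE negb_or xNy /=; apply/negP => ys.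
    case/splitPr: ys yhead xs us sD {sz} => [[|a p1] p2]; first by rewrite eqxx.
    move=> _; have: 0 < size (a :: p1) by [].
    move: (a :: p1) => q q0 + + _.
    rewrite -cat_rcons -cat_cons cat_uniq cat_path => + /andP[us _].
    rewrite rcons_path => /andP[/andP[xq qy] _].
    have sz : 2 < size (x :: rcons q y) by rewrite /= size_rcons !ltnS.
    apply: (G_acyclic sz); rewrite /ucycle us andbT /cycle !rcons_path xq.
    by rewrite last_rcons qy adj_sym xy.
  - by move=> z; rewrite inE => /orP[/eqP ->|/sD].
have [x [s [sz _ us _]]] := long #|G|.
by have := max_card (mem (x :: s)); rewrite (card_uniqP us) /= sz ltnn.
Qed.

(** A vertex with at most one neighbour extends any two-colouring of the rest. *)
Lemma acyclic_bipartite D : exists2 B : {set G},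
  B \subset D & stable B && stable (D :\: B).
Proof.
have [n] := ubnP #|D|; elim: n D => // n IH D; rewrite ltnS => Dn.
have [->|D0] := eqVneq D set0.
  by exists set0 => //; rewrite setD0 andbb; apply/stableP => x y; rewrite inE.
have [x xD xleaf] := acyclic_leaf D0.
have [|B BD /andP[/stableP Bs /stableP BCs]] := IH (D :\ x).
  by apply: leq_trans Dn; rewrite [X in _ < X](cardsD1 x) xD.
have xB : x \notin B by apply/negP => /(fintype.subsetP BD); rewrite setD11.
have sub : B \subset D by apply: fintype.subset_trans BD (subsetDl _ _).
have [/existsP[y /andP[yB xy]]|noadj] := boolP [exists y, (y \in B) && adj x y].
  exists B => //; apply/andP; split; first exact/stableP.
  have xz z : z \in D :\: B -> ~~ adj x z.
    rewrite inE => /andP[zB zD]; apply: contraNN zB => xz.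
    by rewrite -(xleaf y z) // (fintype.subsetP sub).
  apply/stableP => u w; rewrite !inE => /andP[uB uD] /andP[wB wD].
  have [->|ux] := eqVneq u x; first by rewrite xz // inE wB.
  have [->|wx] := eqVneq w x; first by rewrite adj_sym xz // inE uB.
  by apply: BCs; rewrite !inE ?uB ?wB ?ux ?wx.
have xz z : z \in B -> ~~ adj x z.
  by move=> zB; apply: contraNN noadj => xz; apply/existsP; exists z;
    rewrite zB.
exists (x |: B); first by rewrite subUset sub1set xD.
apply/andP; split; last first.
  apply/stableP => u w; rewrite !inE !negb_or =>
    /andP[/andP[ux uB] uD] /andP[/andP[wx wB] wD].
  by apply: BCs; rewrite !inE ?uB ?wB ?ux ?wx.
apply/stableP => u w; rewrite !inE => /orP[/eqP ->|uB] /orP[/eqP ->|wB].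
- by rewrite adj_irr.
- exact: xz.
- by rewrite adj_sym xz.
- exact: Bs.
Qed.

Lemma stable_below (t : {ffun G -> nat}) :
  [set k | @proper_coloring G k]%classic t <->
  forall k, stable_step [set c | t c < k] [set c | t c < k.+1].
Proof.
split=> [tP k|H x y xy txy].
  apply/stableP => x y; rewrite !inE -!leqNgt !ltnS =>
    /andP[kx xk] /andP[ky yk].
  apply/negP => /tP; apply; apply/eqP.
  by rewrite eqn_leq (leq_trans xk ky) (leq_trans yk kx).
have /stableP/(_ x y) := H (t x);
  rewrite !inE -txy !ltnn !ltnSn => /(_ isT isT).
by rewrite xy.
Qed.

Lemma stable_stepT : stable_step setT setT.
Proof. by apply/stableP => x y; rewrite setDv inE. Qed.

Lemma chromatic_chains s :
  chromatic_sym G (content_monomial s) = (chains stable_step s setT)%:R%R.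
Proof. exact: generating_seriesE stable_stepT stable_below. Qed.

End Forests.

(** A rooted tree of height at most two, with [N] the children of the root [v]. The root is its own
    parent, which keeps [p] total; the guards in [adj_parent] discard this loop. *)
Record rooted_depth2 (G : sgraph) (v : G) (N : {set G}) (p : G -> G) : Prop := {
  root_notin : v \notin N;
  parent_root : p v = v;
  parent_child : forall u, u \in N -> p u = v;
  parent_leaf : forall u, u \notin N -> u != v -> p u \in N;
  adj_parent : forall x y,
    adj x y = (x != v) && (p x == y) || (y != v) && (p y == x)
}.

(** * The shape of the tree *)

Section TreeStructure.
Variables (T : sgraph) (v : T) (k : nat).
Hypotheses (treeT : is_tree T) (cardT : #|T| = k.*2) (deg_v : degree v = k).
Hypothesis schurT : schur_positive (chromatic_sym T).

Let N := [set w | adj v w].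

(** A forest has a two-colouring with some class sizes (a, b), so by the two-row inequality it has
    one with sizes (k, k). The class of [v] avoids [N], whose complement also has k elements, so it
    is that complement. *)
Lemma neighbourhood_stable : stable N && stable (~: N).
Proof.
case: treeT => _ acT.
have two U : U \in two_step (@stable_step T)
  setT k -> stable U && stable (~: U).
  by rewrite inE /stable_step setD0 setTD => /and4P[_ _ -> ->].
have {two} [U /andP[Us UCs] kU] : exists2 U : {set T},
  stable U && stable (~: U) & #|U| = k.
  suff : 0 < #|two_step (@stable_step T) setT k|.
    case/card_gt0P => U kU; exists U; first exact: two.
    by move: kU; rewrite inE => /and4P[_ /eqP].
  have [B _ /andP[Bs]] := acyclic_bipartite acT setT; rewrite setTD => BCs.
  have [S Sk /andP[Ss SCs]] : exists2 S : {set T},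
    k <= #|S| & stable S && stable (~: S).
    have [kB|Bk] := leqP k #|B|; first by exists B; rewrite ?Bs.
    exists (~: B); last by rewrite setCK BCs.
    by have := cardsC B; rewrite cardT; lia.
  have abk : #|S| + #|~: S| = k.*2 by rewrite cardsC.
  have := schur_positive_two_rows schurT abk Sk.
  rewrite !chromatic_chains !chains2 ler_nat cardsT cardT abk addnn eqxx !mul1n.
  apply: leq_trans; apply/card_gt0P; exists S.
  by rewrite inE subsetT eqxx /stable_step setD0 setTD Ss SCs.
have vX (X : {set T}) : v \in X -> stable X -> #|X| = k -> X = ~: N.
  move=> vX /stableP Xs kX; apply/eqP; rewrite eqEcard.
  have -> : X \subset ~: N.
    by apply/fintype.subsetP => x xX; rewrite !inE; exact: Xs.
  by have := cardsC N; rewrite -[#|N|]/(degree v) deg_v cardT kX /=; lia.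
have [vU|vU] := boolP (v \in U).
  by rewrite -(vX U) // -[N]setCK -(vX U) // UCs.
have <- : ~: U = ~: N.
  by apply: vX; rewrite ?inE //; have := cardsC U; rewrite cardT; lia.
by rewrite -[N]setCK -(vX (~: U)) ?inE ?setCK ?Us ?UCs //; have := cardsC U;
  rewrite cardT; lia.
Qed.

Lemma tree_rooted_depth2 : exists p, rooted_depth2 v N p.
Proof.
case: treeT => -[_ conT] acT.
have /andP[/stableP Ns /stableP NCs] := neighbourhood_stable.
have vN : v \notin N by rewrite inE adj_irr.
(* Any neighbour may serve as the parent of a leaf: connectedness provides one, and [puniq] shows
   that there is no other. *)
pose p u := if u \in N then v else if u == v then v else odflt v [pick x | adj
  u x].
have pP u : u \notin N -> u != v -> adj u (p u).
  move=> uN uv; rewrite /p (negPf uN) (negPf uv); case: pickP => //= noadj.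
  have /connectP[[|a s] /=] := conT u v; first by move=> _ uE;
    rewrite uE eqxx in uv.
  by rewrite noadj.
have pN u : u \notin N -> u != v -> p u \in N.
  move=> uN uv; apply/negPn/negP => puN.
  by have := NCs u (p u); rewrite !in_setC uN puN pP // => /(_ isT isT).
(* Two neighbours of [u] would both lie in [N] and form a 4-cycle with [u] and [v]. *)
have puniq u x : u \notin N -> u != v -> adj u x -> p u = x.
  move=> uN uv ux; have xN : x \in N.
    by apply/negPn/negP => xN; have := NCs u x;
      rewrite !in_setC uN xN ux => /(_ isT isT).
  apply/eqP/negPn/negP => pux.
  have vx : adj v x by move: xN; rewrite inE.
  have vp : adj v (p u) by move: (pN u uN uv); rewrite inE.
  apply: (acT [:: v; x; u; p u]) => //;
    rewrite /ucycle /= vx [adj x u]adj_sym ux pP //.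
  rewrite [adj (p u) v]adj_sym vp /= !inE !negb_or [v == u]eq_sym uv [x == p
    u]eq_sym pux.
  have neq y : adj v y -> v != y by move=> vy; apply: contraTneq vy => <-;
    rewrite adj_irr.
  have uNx y : y \in N -> u != y by move=> yN; apply: contraNneq uN => ->.
  by rewrite !neq // uNx ?pN // [x == u]eq_sym uNx.
exists p; split => //.
- by rewrite /p eqxx if_same.
- by move=> u uN; rewrite /p uN.
have pv u : u \in N -> p u = v by move=> uN; rewrite /p uN.
have vadj y : adj v y = (y != v) && (p y == v).
  have [->|yv] := eqVneq y v; first by rewrite adj_irr.
  have [yN|yN] := boolP (y \in N); first by rewrite pv // eqxx; move: yN;
    rewrite inE.
  have := yN; rewrite inE => /negPf -> /=; apply/esym/negP => /eqP pyv.
  by have := pN y yN yv; rewrite pyv (negPf vN).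
move=> x y.
have [->|xv] := eqVneq x v; first by rewrite vadj.
have [->|yv] := eqVneq y v; first by rewrite adj_sym vadj xv orbF.
have [xN|xN] := boolP (x \in N); have [yN|yN] := boolP (y \in N) => /=.
- rewrite (negPf (Ns _ _ xN yN)) !pv // ![v == _]eq_sym.
  by rewrite (negPf xv) (negPf yv).
- rewrite [p x]pv // [v == y]eq_sym (negPf yv) /=; apply/idP/eqP => [xy|<-].
    by apply: puniq; rewrite // adj_sym.
  by rewrite adj_sym pP.
- rewrite [p y]pv // [v == x]eq_sym (negPf xv) orbF; apply/idP/eqP => [xy|<-].
    exact: puniq.
  exact: pP.
- have := NCs x y; rewrite !in_setC xN yN => /(_ isT isT)/negPf ->.
  apply/esym/negP => /orP[] /eqP pE.
    by have := pN x xN xv; rewrite pE (negPf yN).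
  by have := pN y yN yv; rewrite pE (negPf xN).
Qed.
End TreeStructure.

Lemma sum_subsets_D1 (A : finType) (V : nmodType) (D : {set A}) (l : A)
  (f : {set A} -> V) :
  l \in D ->
  (\sum_(S : {set A} | S \subset D) f S =
   \sum_(S : {set A} | S \subset D :\ l) (f S + f (l |: S)))%R.
Proof.
move=> lD; rewrite (bigID (fun S : {set A} => l \in S)) /= addrC big_split /=.
congr (_ + _)%R; first by apply: eq_bigl => S; rewrite subsetD1.
rewrite (reindex_onto (fun S => l |: S) (fun S => S :\ l)) /=; last first.
  by move=> S /andP[_ lS]; rewrite setD1K.
apply: eq_bigl => S; rewrite setU11 andbT subUset sub1set lD subsetD1 /=.
congr (_ && _); have [lS|lS] := boolP (l \in S); last by rewrite setU1K ?eqxx.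
by apply/eqP => /setP/(_ l); rewrite setD11 lS.
Qed.

(** * Acyclic orientations invert stable steps *)

Section ForestInverse.
Variables (G : sgraph) (v : G) (N : {set G}) (p : G -> G).
Hypothesis tree : rooted_depth2 v N p.
Implicit Types D S U W : {set G}.

(** The number of edges induced on [D], each counted at its end further from the root. *)
Definition edges D := #|[set u in D | (u != v) && (p u \in D)]|.

Lemma exists_leaf D : D != set0 ->
  exists2 l, l \in D & forall u, u \in D -> u != v -> p u != l.
Proof.
move=> /set0Pn[d dD].
pose h u := if u == v then 0 else if u \in N then 1 else 2.
have hp u : u != v -> h (p u) < h u.
  move=> uv; rewrite /h (negPf uv); have [uN|uN] := boolP (u \in N).
    by rewrite (parent_child tree uN) eqxx.
  have puN := parent_leaf tree uN uv; rewrite puN.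
  by case: eqP.
case: (@arg_maxnP _ d (mem D) h dD) => l lD lmax; exists l => // u uD uv.
by apply/eqP => pu; have := hp u uv; rewrite pu ltnNge => /negP; apply;
  exact: lmax.
Qed.

(** [S] is paired with [l |: S], where [l] has no child in [D]. If the parent of [l] is in [D], the
    pair contributes the term of [S] for [D :\ l]: either [l |: S] is not stable, or the powers of 2
    combine as 2 - 1. If it is not, the pair cancels. *)
Lemma signed_stable_sum D : D != set0 ->
  (\sum_(S : {set G} | S \subset D)
     (-1) ^+ #|S| * (stable S * 2 ^ edges (D :\: S))%:R = 0 :> rat)%R.
Proof.
have [n] := ubnP #|D|; elim: n D => // n IH D; rewrite ltnS => Dn D0.
have [l lD lleaf] := exists_leaf D0.
pose q := (l != v) && (p l \in D).
have pl_neq : l != v -> p l != l by exact: lleaf.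
rewrite (sum_subsets_D1 _ lD).
transitivity (\sum_(S : {set G} | S \subset D :\ l)
    q%:R * ((-1) ^+ #|S| * (stable S * 2 ^ edges ((D :\ l) :\: S))%:R) : rat)%R.
  apply: eq_bigr => S SD; move: (SD); rewrite subsetD1 => /andP[SsD lS].
  have -> : D :\: (l |: S) = (D :\ l) :\: S.
    by apply/setP => x; rewrite !inE negb_or andbCA andbA.
  have -> : stable (l |: S) = stable S && ~~ (q && (p l \in S)).
    apply/idP/andP => [/stableP H|[/stableP H qS]].
      split; first by apply/stableP => x y xS yS; apply: H;
        rewrite inE ?xS ?yS orbT.
      apply/negP => /andP[/andP[lv _] plS].
      have := H l (p l); rewrite !inE eqxx plS orbT => /(_ isT isT).
      by rewrite (adj_parent tree) lv eqxx.
    have lN x : x \in S -> ~~ adj l x.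
      move=> xS; rewrite (adj_parent tree) negb_or; apply/andP; split.
        apply: contraNN qS => /andP[lv /eqP px].
        by rewrite /q lv px (fintype.subsetP SsD) //.
      apply/negP => /andP[xv pxl]; have := lleaf x.
      by rewrite (fintype.subsetP SsD) // xv pxl => /(_ isT isT).
    apply/stableP => x y; rewrite !inE => /orP[/eqP ->|xS] /orP[/eqP ->|yS].
    - by rewrite adj_irr.
    - exact: lN.
    - by rewrite adj_sym lN.
    - exact: H.
  have -> : edges (D :\: S) = edges ((D :\ l) :\: S) + (q && (p l \notin S)).
    rewrite /edges (cardsD1 l) addnC; congr (_ + _).
      apply: eq_card => x; rewrite !inE; have [->|xl] //= := eqVneq x l.
        by rewrite andbF.
      case xS: (x \in S) => //=; case xD: (x \in D) => //=.
      case xv: (x == v) => //=; case: (p x \in S) => //=.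
      by rewrite lleaf ?xv.
    rewrite !inE lS lD /= /q; case: (l == v) => //=; rewrite andbC.
    by case: (p l \in S).
  rewrite cardsU1 lS add1n exprS expnD.
  case: (stable S) => /=; last by rewrite !mul0n !mulr0 addr0.
  move: (2 ^ _) (_ ^+ #|S|)%R => E e.
  by case: q; case: (p l \in S); rewrite /= !natrM; ring.
rewrite -mulr_sumr; case qE: q; last by rewrite mul0r.
rewrite mul1r; apply: IH.
  by move: Dn; rewrite (cardsD1 l) lD.
case/andP: qE => lv plD; apply/set0Pn; exists (p l).
by rewrite !inE pl_neq.
Qed.

(* The number of acyclic orientations of the forest induced on W :\: U. *)
Definition edge_weight U W := 2 ^ edges (W :\: U).

Lemma edge_weight_refl U : edge_weight U U = 1.
Proof.
rewrite /edge_weight /edges setDv (_ : [set _ in _ | _] = set0) ?cards0 //.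
by apply/setP => x; rewrite !inE.
Qed.

Lemma edge_weight_inv U W : U \proper W ->
  ((edge_weight U W)%:R +
   \sum_(B : {set G} | [&& U \subset B, B \proper W & stable_step B W])
     (-1) ^+ #|W :\: B| * (edge_weight U B)%:R = 0 :> rat)%R.
Proof.
move=> UpW; have UW := proper_sub UpW.
have D0 : W :\: U != set0 by rewrite setD_eq0; case/properP: UpW => _ [x xW xU];
  apply/fintype.subsetPn; exists x.
rewrite -[RHS](signed_stable_sum D0).
transitivity (\sum_(B : {set G} | (U \subset B) && (B \subset W))
   (-1) ^+ #|W :\: B| * (stable (W :\: B) * edge_weight U B)%:R : rat)%R.
  rewrite [RHS](bigD1 W) /=; last by rewrite UW subxx.
  have -> : stable (W :\: W) by apply/stableP => x y; rewrite setDv inE.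
  rewrite setDv cards0 expr0 !mul1r mul1n; congr (_ + _)%R.
  rewrite [LHS](eq_bigl (fun B : {set G} =>
    (U \subset B) && (B \proper W) && stable (W :\: B)));
    last by move=> B; rewrite andbA.
  rewrite [LHS]big_mkcondr /=; apply: eq_big => B.
    by rewrite properEneq [(B != W) && _]andbC andbA.
  by move=> _; case: stable; rewrite ?mul1n ?mul0n ?mulr0.
rewrite (reindex_onto (fun S => W :\: S) (fun B => W :\: B)) /=; last first.
  by move=> B /andP[_ BW]; rewrite setDDr setDv set0U (setIidPr BW).
have DDS S : W :\: (W :\: S) = W :&: S by rewrite setDDr setDv set0U.
apply: eq_big => [S|S /andP[_ /eqP ->]].
  rewrite DDS !subsetD UW subsetDl andbT disjoint_sym andbC; congr (_ && _).
  by apply/eqP/idP => [<-|/setIidPr //]; exact: subsetIl.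
by rewrite /edge_weight !setDDl setUC.
Qed.
End ForestInverse.

(** * Transfer along the tree *)

Lemma prod_sum_subsets (A : finType) (R : comNzRingType) (D : {set A})
  (f : A -> bool -> R) :
  (\prod_(u in D) (f u false + f u true) =
   \sum_(S : {set A} | S \subset D) \prod_(u in D) f u (u \in S))%R.
Proof.
have [n] := ubnP #|D|; elim: n D => // n IH D; rewrite ltnS => Dn.
have [->|/set0Pn[l lD]] := eqVneq D set0.
  rewrite big_set0 (big_pred1 set0) ?big_set0 // => S.
  by rewrite subset0.
rewrite (sum_subsets_D1 _ lD) (big_setD1 l) //= IH; last first.
  by move: Dn; rewrite (cardsD1 l) lD.
rewrite mulr_sumr; apply: eq_bigr => S; rewrite subsetD1 => /andP[_ lS].
rewrite !(big_setD1 l lD) /= setU11 (negPf lS) mulrDl; congr (_ * _ + _ * _)%R.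
by apply: eq_bigr => u; rewrite !inE => /andP[/negPf -> _].
Qed.

Lemma sum_sets_split (A : finType) (V : nmodType) (D : {set A})
  (F : {set A} -> V) :
  (\sum_(B : {set A}) F B =
   \sum_(S : {set A} | S \subset D) \sum_(C : {set A} | C \subset ~: D)
     F (S :|: C))%R.
Proof.
rewrite pair_big_dep /=.
rewrite (reindex_onto (fun q : {set A} * {set A} => q.1 :|: q.2)
  (fun B => (B :&: D, B :&: ~: D))) /=; last first.
  by move=> B _; rewrite -setIUr setUCr setIT.
apply: eq_bigl => -[S C] /=; rewrite xpair_eqE !setIUl.
apply/andP/andP => -[].
  by move=> /eqP <- /eqP <-; rewrite !subUset !subsetIr.
move=> SD CD.
have -> : C :&: D = set0 by apply/eqP; rewrite setI_eq0 disjoints_subset.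
have -> : S :&: ~: D = set0 by apply/eqP;
  rewrite setI_eq0 disjoints_subset setCK.
by rewrite (setIidPl SD) (setIidPl CD) setU0 set0U !eqxx.
Qed.

Section Transfer.
Variables (G : sgraph) (v : G) (N : {set G}) (p : G -> G).
Hypothesis tree : rooted_depth2 v N p.
Implicit Types B M S : {set G}.
Local Open Scope ring_scope.

Definition leaves := ~: (v |: N).

Lemma in_leaves u : (u \in leaves) = (u != v) && (u \notin N).
Proof. by rewrite !inE negb_or. Qed.

(** Once the states of the root (x) and of its children (y) are fixed, the leaves (z) are
    independent. The root has weight [psi v x x] because it is its own parent. *)
Lemma transfer (R : comNzRingType) (psi : G -> bool -> bool -> R) :
  \sum_(B : {set G}) \prod_u psi u (u \in B) (p u \in B) =
  \sum_(x : bool) psi v x x * \prod_(j in N) \sum_(y : bool)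
     psi j y x * \prod_(w in leaves | p w == j) \sum_(z : bool) psi w z y.
Proof.
have vN := root_notin tree.
rewrite (sum_sets_split (v |: N)).
pose Q S := psi v (v \in S) (v \in S) * (\prod_(j in N) psi j (j \in S)
  (v \in S)) *
  \prod_(u in leaves) (psi u false (p u \in S) + psi u true (p u \in S)).
transitivity (\sum_(S : {set G} | S \subset v |: N) Q S).
  apply: eq_bigr => S SD; 
  rewrite /Q (prod_sum_subsets _ (fun u z => psi u z (p u \in S))) mulr_sumr.
  apply: eq_bigr => C CD.
  have inD u : u \in v |: N -> (u \in S :|: C) = (u \in S).
    move=> uD; rewrite inE; case: (boolP (u \in C)) => [|_];
      last by rewrite orbF.
    by move=> /(fintype.subsetP CD); rewrite inE uD.
  have pD u : p u \in v |: N.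
    rewrite !inE; have [->|uv] := eqVneq u v;
      first by rewrite (parent_root tree) eqxx.
    have [uN|uN] := boolP (u \in N);
      first by rewrite (parent_child tree uN) eqxx.
    by rewrite (parent_leaf tree uN uv) orbT.
  rewrite (bigID (mem (v |: N))) /= big_setU1 //=; congr (_ * _ * _).
  - by rewrite (parent_root tree) inD ?setU11.
  - apply: eq_bigr => j jN; rewrite !inD ?(parent_child tree jN) ?setU11 //.
    by rewrite inE jN orbT.
  - apply: eq_big => [u|u uD]; first by rewrite /leaves in_setC.
    rewrite (inD _ (pD u)) inE; case: (boolP (u \in S)) => [uS|//].
    by rewrite (fintype.subsetP SD _ uS) in uD.
have vD : v \in v |: N by exact: setU11.
rewrite (sum_subsets_D1 _ vD) setU1K //.
rewrite [RHS]big_bool [RHS]addrC [LHS]big_split /=.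
have group S x : S \subset N -> Q (if x then v |: S else S) = psi v x x *
   \prod_(j in N) (fun j y => psi j y x * \prod_(w in leaves | p w == j)
      (\sum_(z : bool) psi w z y)) j (j \in S).
  move=> SN; have vS : v \notin S by apply: contraNN vN;
    exact: (fintype.subsetP SN).
  have vx : (v \in if x then v |: S else S) = x.
    by case: x; rewrite ?setU11 // (negPf vS).
  have jx j : j \in N -> (j \in if x then v |: S else S) = (j \in S).
    move=> jN; case: x {vx} => //; rewrite !inE; case: eqP => // jv.
    by rewrite -jv jN in vN.
  rewrite /Q vx -mulrA; congr (_ * _); rewrite big_split /=; congr (_ * _).
    by apply: eq_bigr => j /jx ->.
  rewrite (partition_big p (mem N)) /=; last first.
    by move=> u; rewrite in_leaves => /andP[uv uN];
      rewrite (parent_leaf tree uN uv).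
  apply: eq_bigr => j jN; apply: eq_bigr => u /andP[_ /eqP ->].
  by rewrite jx // big_bool addrC.
congr (_ + _).
  rewrite [LHS](eq_bigr _ (fun S => @group S false)) -mulr_sumr; congr (_ * _).
  under [RHS]eq_bigr do rewrite big_bool /= addrC.
  by rewrite (prod_sum_subsets N (fun j y => psi j y false *
    \prod_(w in leaves | p w == j) \sum_(z : bool) psi w z y)).
rewrite [LHS](eq_bigr _ (fun S => @group S true)) -mulr_sumr; congr (_ * _).
under [RHS]eq_bigr do rewrite big_bool /= addrC.
by rewrite (prod_sum_subsets N (fun j y => psi j y true *
  \prod_(w in leaves | p w == j) \sum_(z : bool) psi w z y)).
Qed.
End Transfer.

Lemma coef_sum_sets (A : finType) (R : comNzRingType) (c : {set A} -> nat) a :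
  ((\sum_(B : {set A}) (c B)%:R * 'X^#|B| : {poly R})`_a =
   (\sum_(B : {set A} | #|B| == a) c B)%:R)%R.
Proof.
rewrite coef_sum natr_sum [RHS]big_mkcond; apply: eq_bigr => B _ /=.
rewrite -polyC_natr coefCM coefXn eq_sym.
by case: eqP => _; rewrite ?mulr1 ?mulr0.
Qed.

(** * Two-colourings of the tree after deletion of vertices *)

Section ColoringPolynomials.
Variables (G : sgraph) (v : G) (N : {set G}) (p : G -> G).
Hypothesis tree : rooted_depth2 v N p.
Variable R : comNzRingType.
Implicit Types B M S : {set G}.
Local Open Scope ring_scope.

Let L := leaves v N.
Definition nleaves (j : G) := #|[set w in L | p w == j]|.

(* The vertices of M are deleted from the graph: they stay out of B and impose
   no condition on their neighbours. *)
Definition deletion_weight M (u : G) (z y : bool) : {poly R} :=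
  if u \in M then (if z then 0 else 1)
  else 'X^z * (if [&& u != v, p u \notin M & z == y] then 0 else 1).

Definition coloring_poly M : {poly R} :=
  \sum_(B : {set G}) \prod_u deletion_weight M u (u \in B) (p u \in B).

Lemma prod_Xn_mem B : \prod_u 'X^(u \in B) = 'X^#|B| :> {poly R}.
Proof. by rewrite prodrXr -sum1_card [in RHS]big_mkcond. Qed.

Lemma prod_deletion_weight M B :
  \prod_u deletion_weight M u (u \in B) (p u \in B) =
  ([&& B \subset ~: M, stable B & stable (~: M :\: B)] : nat)%:R * 'X^#|B|.
Proof.
have [/and3P[BM /stableP Bs /stableP Cs]|bad] := boolP [&& _, _ & _].
  rewrite mul1r -prod_Xn_mem; apply: eq_bigr => u _; rewrite /deletion_weight.
  have [uM|uM] := boolP (u \in M).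
    have /negPf -> // : u \notin B.
    by apply: contraL uM => /(fintype.subsetP BM); rewrite inE.
  case: ifP => [/and3P[uv puM /eqP upu]|_]; last by rewrite mulr1.
  have au : adj u (p u) by rewrite (adj_parent tree) uv eqxx.
  have [uB|uB] := boolP (u \in B).
    by move: (Bs u (p u)); rewrite -upu uB au => /(_ isT isT).
  by move: (Cs u (p u)); rewrite !inE -upu uB uM puM au => /(_ isT isT).
rewrite mul0r.
suff [u u0] : exists u, deletion_weight M u (u \in B) (p u \in B) = 0.
  by rewrite (bigD1 u) //= u0 mul0r.
have [BM|/subsetPn[u uB]] := boolP (B \subset ~: M); last first.
  by rewrite inE negbK => uM; exists u; rewrite /deletion_weight uM uB.
have bad_edge u : u != v -> u \notin M -> p u \notin M -> (u \in B)
  = (p u \in B) ->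
    deletion_weight M u (u \in B) (p u \in B) = 0.
  by move=> uv uM puM upu; rewrite /deletion_weight (negPf uM)
    uv puM upu eqxx mulr0.
have bad_adj x y : x \notin M -> y \notin M -> (x \in B) = (y \in B)
  -> adj x y ->
    exists u, deletion_weight M u (u \in B) (p u \in B) = 0.
  move=> xM yM xy; rewrite (adj_parent tree) => /orP[] /andP[uv /eqP pu].
    by exists x; apply: bad_edge; rewrite ?pu.
  by exists y; apply: bad_edge; rewrite ?pu.
move: bad; rewrite BM /= negb_and => /orP[].
  rewrite /stable => /forallPn[x /forallPn[y]]; rewrite negb_imply negbK.
  move=> /andP[/andP[xB yB] xy]; apply: bad_adj xy; rewrite ?xB ?yB //.
    by have := fintype.subsetP BM _ xB; rewrite inE.
  by have := fintype.subsetP BM _ yB; rewrite inE.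
rewrite /stable => /forallPn[x /forallPn[y]]; rewrite negb_imply negbK.
rewrite !inE => /andP[/andP[/andP[xB xM] /andP[yB yM]] xy].
by apply: bad_adj xy => //; rewrite (negPf xB) (negPf yB).
Qed.

Lemma coef_coloring_poly M a :
  (coloring_poly M)`_a = #|two_step (@stable_step G) (~: M) a|%:R.
Proof.
rewrite /coloring_poly; under eq_bigr do rewrite prod_deletion_weight.
rewrite coef_sum_sets -sum1_card; congr _%:R.
rewrite big_mkcond [RHS]big_mkcond; apply: eq_bigr => B _;
  rewrite inE /stable_step setD0.
by case: (#|B| == a); case: (B \subset _); case: (stable B); case: (stable _).
Qed.

Lemma prod_leaves (f : G -> {poly R}) :
  \prod_(j in N) \prod_(w in L | p w == j) f w = \prod_(w in L) f w.
Proof.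
rewrite [RHS](partition_big p (mem N)) //= => u.
by rewrite in_leaves => /andP[uv uN]; rewrite (parent_leaf tree uN uv).
Qed.

Lemma prod_siblings (x : {poly R}) j : \prod_(w in L | p w == j)
  x = x ^+ nleaves j.
Proof. by rewrite -prodr_const; apply: eq_bigl => w; rewrite inE. Qed.

Lemma sum_nleaves : (\sum_(j in N) nleaves j = #|L|)%N.
Proof.
rewrite -sum1_card [RHS](partition_big p (mem N)) /=.
  by apply: eq_bigr => j _; rewrite /nleaves -sum1_card; apply: eq_bigl => w;
    rewrite inE.
by move=> u; rewrite in_leaves => /andP[uv uN];
  rewrite (parent_leaf tree uN uv).
Qed.

(** The total weight of a leaf [w] over its two states, given the state [y] of its parent. *)
Let leaf_factor M w y : {poly R} :=
  if w \in M then 1 else if p w \in M then 1 + 'X else 'X^(~~ y).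

Lemma coloring_poly_transfer M : coloring_poly M =
  \sum_(x : bool) deletion_weight M v x x * \prod_(j in N) \sum_(y : bool)
     deletion_weight M j y x * \prod_(w in L | p w == j) leaf_factor M w y.
Proof.
rewrite /coloring_poly (transfer tree); apply: eq_bigr => x _; congr (_ * _).
apply: eq_bigr => j _; apply: eq_bigr => y _; congr (_ * _).
apply: eq_bigr => w /andP[]; rewrite in_leaves => /andP[wv _] _.
rewrite big_bool /= /deletion_weight /leaf_factor wv.
case: ifP => _; first by rewrite add0r.
by case: (p w \in M) => /=; case: y;
  rewrite /= ?mulr1 ?mulr0 ?addr0 ?add0r // addrC.
Qed.

(** Without the root the tree falls into stars, and in each star the class consists of the centre or
    of its leaves. *)
Lemma coloring_poly_root : coloring_poly [set v] = \prod_(j in N)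
  ('X + 'X^(nleaves j)).
Proof.
rewrite coloring_poly_transfer big_bool /deletion_weight !inE eqxx /= mul0r
  add0r mul1r.
apply: eq_bigr => j jN; rewrite big_bool /= inE (parent_child tree jN)
  inE eqxx /= andbF.
have -> : (j == v) = false by apply/eqP => jv; have := root_notin tree;
  rewrite -jv jN.
rewrite !mulr1 expr0 mul1r -prod_siblings; congr (_ + _).
  rewrite big1 ?mulr1 // => w /andP[]; rewrite in_leaves => /andP[wv wN] _.
  rewrite /leaf_factor !inE (negPf wv).
  by case: eqP => // pwv; have := parent_leaf tree wN wv;
    rewrite pwv (negPf (root_notin tree)).
apply: eq_bigr => w /andP[]; rewrite in_leaves => /andP[wv wN] _.
rewrite /leaf_factor !inE (negPf wv).
by case: eqP => // pwv; have := parent_leaf tree wN wv;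
  rewrite pwv (negPf (root_notin tree)).
Qed.

Lemma coloring_poly_nonroot M : v \notin M -> coloring_poly M =
  \sum_(x : bool) 'X^x * \prod_(j in N)
     (if j \in M then \prod_(w in L | p w == j) leaf_factor M w false
      else 'X^(~~ x) * \prod_(w in L | p w == j) leaf_factor M w (~~ x)).
Proof.
move=> vM; rewrite coloring_poly_transfer; apply: eq_bigr => x _.
rewrite /deletion_weight (negPf vM) eqxx mulr1; congr (_ * _).
apply: eq_bigr => j jN; rewrite big_bool /= (parent_child tree jN) vM.
have -> : (j == v) = false by apply/eqP => jv; have := root_notin tree;
  rewrite -jv jN.
case: ifP => _; first by rewrite mul0r add0r mul1r.
by case: x; rewrite /= !mulr1 !mulr0 mul0r ?add0r ?addr0.
Qed.

Lemma leafL w : w \in L -> p w \in N.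
Proof. by rewrite in_leaves => /andP[wv wN];
  exact: (parent_leaf tree wN wv). Qed.

(** By connectedness there are only two colourings: the class is [N], or the root together with all
    leaves. *)
Lemma coloring_poly_set0 : coloring_poly set0 = 'X^#|N| + 'X^(#|L|.+1).
Proof.
rewrite coloring_poly_nonroot ?inE // big_bool /= addrC expr0 mul1r expr1 [in
  RHS]exprS.
congr (_ + _ * _).
  rewrite -prodr_const; apply: eq_bigr => j _;
    rewrite inE /= big1 ?mulr1 // => w _.
  by rewrite /leaf_factor !inE.
rewrite -prodr_const -prod_leaves; apply: eq_bigr => j _;
  rewrite inE /=. rewrite mul1r.
by apply: eq_bigr => w _; rewrite /leaf_factor !inE.
Qed.

Lemma coloring_poly_leaf w : w \in L -> coloring_poly [set w] = 'X^#|N| +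
  'X^#|L|.
Proof.
move=> wL; have := wL; rewrite in_leaves => /andP[wv wN].
have pN u : u \in N -> (u == w) = false.
  by move=> uN; apply/eqP => uw; rewrite -uw uN in wN.
rewrite coloring_poly_nonroot ?inE 1?eq_sym // big_bool /= addrC expr0 mul1r
  expr1.
congr (_ + _).
  rewrite -prodr_const; apply: eq_bigr => j jN;
    rewrite inE pN //= big1 ?mulr1 // => u /andP[uL _].
  by rewrite /leaf_factor !inE (pN _ (leafL uL)) /= expr0 if_same.
transitivity ('X * \prod_(u in L) (if u == w then 1 else 'X) : {poly R}).
  congr (_ * _); rewrite -prod_leaves; apply: eq_bigr => j jN;
    rewrite inE pN //= mul1r.
  apply: eq_bigr => u /andP[uL _].
  by rewrite /leaf_factor !inE (pN _ (leafL uL)).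
rewrite (big_setD1 w) //= eqxx mul1r (cardsD1 w L) wL exprS; congr (_ * _).
by rewrite -prodr_const; apply: eq_bigr => u; rewrite !inE => /andP[/negPf ->].
Qed.

(** Deleting a child isolates its leaves, each of which gives a factor 1 + X; the rest stays
    connected and has two colourings. *)
Lemma coloring_poly_child i : i \in N -> coloring_poly [set i] =
  'X^(#|N|.-1) * (1 + 'X) ^+ nleaves i + 'X^((#|L| - nleaves i).+1) * (1 + 'X)
    ^+ nleaves i.
Proof.
move=> iN.
have vi : v \notin [set i] by rewrite inE;
  apply: contraNneq (root_notin tree) => ->.
have iprod y : \prod_(w in L | p w == i) leaf_factor [set i] w y = (1 + 'X)
  ^+ nleaves i.
  rewrite -prod_siblings; apply: eq_bigr => w /andP[wL pw].
  rewrite /leaf_factor !inE pw; case: eqP => // wi.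
  by move: wL; rewrite wi in_leaves iN andbF.
have jprod j y : j != i -> \prod_(w in L | p w == j) leaf_factor [set i] w y =
    'X^(~~ y) ^+ nleaves j.
  move=> ji; rewrite -prod_siblings; apply: eq_bigr => w /andP[wL /eqP pw].
  rewrite /leaf_factor !inE pw (negPf ji); case: eqP => // wi.
  by move: wL; rewrite wi in_leaves iN andbF.
rewrite coloring_poly_nonroot // big_bool /= addrC expr0 mul1r expr1.
rewrite !(big_setD1 i iN) /= inE eqxx !iprod; congr (_ + _).
  rewrite mulrC; congr (_ * _).
  have -> : #|N|.-1 = #|N :\ i| by rewrite (cardsD1 i N) iN.
  rewrite -prodr_const; apply: eq_bigr => j; rewrite !inE => /andP[ji _].
  by rewrite (negPf ji) jprod //= ?expr0 expr1n mulr1.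
rewrite mulrCA mulrC exprS; congr (_ * _ * _).
rewrite -sum_nleaves (big_setD1 i iN) /= addKn -prodrXr; apply: eq_bigr => j.
by rewrite !inE => /andP[ji _];
  rewrite (negPf ji) jprod //= ?expr0 mul1r ?expr1.
Qed.
End ColoringPolynomials.

(** * Two-colourings weighted by monochromatic edges *)

Section EdgePolynomial.
Variables (G : sgraph) (v : G) (N : {set G}) (p : G -> G).
Hypothesis tree : rooted_depth2 v N p.
Variable R : comNzRingType.
Implicit Types B : {set G}.
Local Open Scope ring_scope.

Definition edge_poly : {poly R} :=
  \sum_(B : {set G}) (2 ^ (edges v p B + edges v p (~: B)))%N%:R * 'X^#|B|.

(** The two summands have the root inside and outside [B], and the two terms of each factor have a
    child inside and outside [B]. A factor 2 marks a vertex in the same class as its parent. *)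
Lemma edge_polyE : edge_poly =
  'X * \prod_(j in N) (2%:R * 'X * (2%:R * 'X + 1)
    ^+ nleaves v N p j + ('X + 2%:R) ^+ nleaves v N p j) +
  \prod_(j in N) ('X * (2%:R * 'X + 1) ^+ nleaves v N p j + 2%:R * ('X + 2%:R)
    ^+ nleaves v N p j).
Proof.
pose psi u (z y : bool) : {poly R} := 'X^z * (if (u != v) && (z == y)
  then 2%:R else 1).
transitivity (\sum_(B : {set G}) \prod_u psi u (u \in B) (p u \in B)).
  apply: eq_bigr => B _; rewrite /psi big_split /= prod_Xn_mem mulrC;
    congr (_ * _).
  rewrite natrX -big_mkcond prodr_const; congr (_ ^+ _).
  transitivity #|[set u | (u != v) && ((u \in B) == (p u \in B))]|; last first.
    by apply: eq_card => u; rewrite inE.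
  rewrite /edges -[RHS](cardsID B); congr addn; apply: eq_card => u;
    rewrite !inE;
    by case: (u \in B); case: (u == v); case: (p u \in B).
rewrite (transfer tree) big_bool /=.
have leaf w y : w \in leaves v N -> \sum_(z : bool) psi w z y =
    if y then 2%:R * 'X + 1 else 'X + 2%:R.
  rewrite in_leaves => /andP[wv _]; rewrite big_bool /psi wv /= expr0 expr1.
  by case: y; rewrite ?mulr1 ?mul1r // mulrC.
have sib j y : \prod_(w in leaves v N | p w == j) (\sum_(z : bool) psi w z y) =
    (if y then 2%:R * 'X + 1 else 'X + 2%:R) ^+ nleaves v N p j.
  rewrite (eq_bigr (fun=> if y then 2%:R * 'X + 1 else 'X + 2%:R)); last first.
    by move=> w /andP[/leaf].
  exact: prod_siblings.
have jv j : j \in N -> j != v.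
  by move=> jN; apply: contraTneq jN => ->; exact: root_notin tree.
congr (_ + _).
  rewrite [psi v _ _]/psi eqxx /= mulr1; congr (_ * _); apply: eq_bigr => j jN.
  rewrite big_bool !sib /psi jv //=; ring.
rewrite [psi v _ _]/psi eqxx /= !mul1r; apply: eq_bigr => j jN.
rewrite big_bool !sib /psi jv //=; ring.
Qed.
End EdgePolynomial.

(** * Polynomials as lists of binary integers *)

Section ListPolynomials.

(** Coefficient lists, constant term first, are a form that [vm_compute] evaluates; [Poly]
    translates them into polynomials. *)
Fixpoint ladd (s t : seq BinNums.Z) : seq BinNums.Z :=
  match s, t with
  | a :: s', b :: t' => BinInt.Z.add a b :: ladd s' t'
  | [::], _ => t
  | _, [::] => s
  end.

Definition lmul (s t : seq BinNums.Z) : seq BinNums.Z :=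
  foldr (fun a r => ladd (map (BinInt.Z.mul a) t) (BinNums.Z0 :: r)) [::] s.

Definition lexp (s : seq BinNums.Z) n : seq BinNums.Z := iter n (lmul s)
  [:: 1%R].

Definition lX n : seq BinNums.Z := ncons n BinNums.Z0 [:: 1%R].

Local Open Scope ring_scope.

Lemma Poly_ladd s t : Poly (ladd s t) = Poly s + Poly t.
Proof.
elim: s t => [|a s IH] [|b t] //=; rewrite ?add0r ?addr0 //.
by rewrite !cons_poly_def IH mulrDl -[BinInt.Z.add a b]/(a + b) polyCD; ring.
Qed.

Lemma Poly_scale a t : Poly (map (BinInt.Z.mul a) t) = a%:P * Poly t.
Proof.
elim: t => [|b t IH] /=; first by rewrite mulr0.
by rewrite !cons_poly_def IH -[BinInt.Z.mul a b]/(a * b) polyCM; ring.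
Qed.

Lemma Poly_lmul s t : Poly (lmul s t) = Poly s * Poly t.
Proof.
elim: s => [|a s IH]; first by rewrite mul0r.
rewrite [lmul _ _]/(ladd _ (_ :: lmul s t))
  Poly_ladd Poly_scale /= !cons_poly_def IH.
by rewrite polyC0; ring.
Qed.

Lemma Poly_lexp s n : Poly (lexp s n) = Poly s ^+ n.
Proof.
elim: n => [|n IH]; first by rewrite expr0 /= cons_poly_def mul0r add0r.
by rewrite exprS -IH -Poly_lmul.
Qed.

Lemma Poly_lX n : Poly (lX n) = 'X^n.
Proof.
elim: n => [|n IH]; first by rewrite /= cons_poly_def mul0r add0r.
by rewrite /= cons_poly_def IH addr0 exprSr.
Qed.

Lemma Poly_big_lmul (I : Type) (r : seq I) (f : I -> seq BinNums.Z) :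
  Poly (foldr (fun i => lmul (f i)) [:: 1%R] r) = \prod_(i <- r) Poly (f i).
Proof.
elim: r => [|i r IH] /=; last by rewrite Poly_lmul IH big_cons.
by rewrite big_nil cons_poly_def mul0r add0r.
Qed.

Lemma Poly_big_ladd (I : Type) (r : seq I) (f : I -> seq BinNums.Z) :
  Poly (foldr (fun i => ladd (f i)) [::] r) = \sum_(i <- r) Poly (f i).
Proof.
by elim: r => [|i r IH] /=; [rewrite big_nil|rewrite Poly_ladd IH big_cons].
Qed.
End ListPolynomials.

(** * The thirty cases *)

Section Certificate.
Local Open Scope ring_scope.

Definition deletion_list (s : seq nat) : seq BinNums.Z :=
  ladd (foldr (fun c => lmul (ladd (lX 1) (lX c))) [:: 1] s)
    (ladd (foldr (fun c => ladd (ladd (lmul (lX 9) (lexp [:: 1; 1] c))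
                                      (lmul (lX (9 - c).+1) (lexp [:: 1;
                                        1] c)))) [::] s)
       (lmul [:: 9%:R] (ladd (lX 10) (lX 9)))).

Definition edge_list (s : seq nat) : seq BinNums.Z :=
  ladd (lmul (lX 1)
          (foldr (fun c => lmul (ladd (lmul [:: 0; 2%:R] (lexp [:: 1; 2%:R] c))
                                      (lexp [:: 2%:R; 1] c))) [:: 1] s))
    (foldr (fun c => lmul (ladd (lmul (lX 1) (lexp [:: 1; 2%:R] c))
                                (lmul [:: 2%:R] (lexp [:: 2%:R;
                                  1] c)))) [:: 1] s).

(** The second inequality compares the contents (11, 8, 1) and (10, 9, 1), the third e_11 e_9 and
    e_10 e_10, whence the degrees 11 and 10. The 2 is the coefficient of the content (10, 10); that
    of (12, 8) is 0. *)
Definition survives s :=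
  (nth 0 (deletion_list s) 11 + 2%:R <= nth 0 (deletion_list s) 10) &&
  (nth 0 (edge_list s) 11 <= nth 0 (edge_list s) 10).

(** Zero parts are allowed, for children without leaves, so every list has length exactly [k]. *)
Fixpoint bounded_partitions (k n m : nat) : seq (seq nat) :=
  if k is k'.+1 then
    flatten [seq [seq i :: s | s <- bounded_partitions k' (n - i)%N i]
            | i <- iota 0 (minn n m).+1]
  else if n == 0%N then [:: [::]] else [::].

Lemma mem_bounded_partitions s m :
  path geq m s -> s \in bounded_partitions (size s) (sumn s) m.
Proof.
elim: s m => [//|i s IH] m /andP[im si].
have E k n : bounded_partitions k.+1 n m = flatten [seq
  [seq j :: t | t <- bounded_partitions k (n - j)%N j] | j <- iota 0 (minn n
    m).+1] by [].
rewrite E; apply/flattenP; exists [seq i :: t | t <- bounded_partitions (size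
  s) (sumn s) i].
  apply/mapP; exists i; last by rewrite /= addKn.
  by rewrite mem_iota add0n ltnS leq_min /= leq_addr; exact: im.
by rewrite map_f // IH.
Qed.

Lemma no_survivor : all (fun s => ~~ survives s) (bounded_partitions 10 9 9).
Proof. by vm_compute. Qed.

(* The sum of [coloring_poly [set r]] over all vertices r: the root, the ten
   children, and the nine leaves. *)
Definition deletion_total (s : seq nat) : {poly BinNums.Z} :=
  \prod_(c <- s) ('X + 'X^c) +
  (\sum_(c <- s) ('X^9 * (1 + 'X) ^+ c + 'X^((9 - c).+1) * (1 + 'X) ^+ c) +
   9%:R * ('X^10 + 'X^9)).

Definition edge_total (s : seq nat) : {poly BinNums.Z} :=
  'X * \prod_(c <- s) (2%:R * 'X * (2%:R * 'X + 1) ^+ c + ('X + 2%:R) ^+ c) +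
  \prod_(c <- s) ('X * (2%:R * 'X + 1) ^+ c + 2%:R * ('X + 2%:R) ^+ c).

Let PolyE := (Poly_ladd, Poly_lmul, Poly_lexp, Poly_lX, Poly_big_lmul,
  Poly_big_ladd).

Lemma Poly_deletion_list s : Poly (deletion_list s) = deletion_total s.
Proof.
rewrite /deletion_list !PolyE; congr (_ + (_ + _)).
- by apply: eq_bigr => c _; rewrite !PolyE expr1.
- apply: eq_bigr => c _; rewrite !PolyE /= !cons_poly_def mul0r add0r mul1r.
  by rewrite [1 + 'X]addrC.
- by rewrite /= cons_poly_def mul0r add0r polyC_natr.
Qed.

Lemma Poly_edge_list s : Poly (edge_list s) = edge_total s.
Proof.
rewrite /edge_list !PolyE expr1; congr (_ * _ + _); apply: eq_bigr => c _;
  rewrite !PolyE /=.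
  by rewrite !cons_poly_def !mul0r !add0r !polyC_natr polyC1 mul1r polyC0 addr0.
by rewrite !cons_poly_def !mul0r !add0r !polyC_natr polyC1 mul1r expr1.
Qed.

Lemma survivesE s : survives s =
  ((deletion_total s)`_11 + 2%:R <= (deletion_total s)`_10) &&
  ((edge_total s)`_11 <= (edge_total s)`_10).
Proof. by rewrite /survives -Poly_deletion_list -Poly_edge_list !coef_Poly. Qed.

(** The symmetry in [s] is visible on the polynomial side, as commutativity of sums and products. It
    allows the leaf counts to be sorted. *)
Lemma perm_survives s t : perm_eq s t -> survives s = survives t.
Proof.
move=> st; rewrite !survivesE.
have -> : deletion_total s = deletion_total t.
  by rewrite /deletion_total; congr (_ + (_ + _)); exact: perm_big.
have -> // : edge_total s = edge_total t.
by rewrite /edge_total; congr (_ * _ + _); exact: perm_big.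
Qed.

Lemma not_survives s : size s = 10%N -> sumn s = 9%N -> ~~ survives s.
Proof.
move=> s10 s9; rewrite -(perm_survives (permEl (perm_sort geq s))).
apply: (allP no_survivor); set t := sort _ _.
have st : perm_eq t s := permEl (perm_sort geq s).
have := @mem_bounded_partitions t 9.
rewrite (perm_size st) s10 (perm_sumn st) s9; apply.
have t_sorted : sorted geq t by apply: sort_sorted => x y; exact: leq_total.
rewrite path_min_sorted //; apply/allP => x xt.
rewrite /= -s9 -(perm_sumn st).
by rewrite (perm_sumn (perm_to_rem xt)) /= leq_addr.
Qed.
End Certificate.

(** The letter used once sits on a single vertex [r], always a stable set, and the two other letters
    colour what is left. *)
Lemma chains_delete_vertex (G : sgraph) a b : #|G| = (a + b).+1 ->
  chains (@stable_step G) [:: 1; b; a] setT =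
  \sum_(r : G) #|two_step (@stable_step G) (~: [set r]) a|.
Proof.
move=> cardG.
transitivity (\sum_(W in [set ~: [set r] | r : G]) #|two_step (@stable_step G)
  W a|).
  rewrite [LHS]/(chains _ (1 :: [:: b; a]) setT) [LHS]/=.
  apply: eq_big => W.
    rewrite subsetT setTD /=; apply/andP/imsetP =>
      [[/cards1P[r Wr] _]|[r _ ->]].
      by exists r; rewrite // -Wr setCK.
    rewrite setCK cards1; split=> //; apply/stableP => x y;
      rewrite setTD setCK !inE.
    by move=> /eqP -> /eqP ->; rewrite adj_irr.
  rewrite setTD => /and3P[_ /eqP W1 _].
  rewrite -[LHS]/(chains _ [:: b; a] W) chains2.
  suff -> : #|W| = a + b by rewrite eqxx mul1n.
  by have := cardsC W; rewrite W1 cardG addn1 => -[].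
by rewrite big_imset //= => r r' _ _ /setC_inj/set1_inj.
Qed.

Theorem theorem1 (T : sgraph) (treeT : is_tree T) (cardT : #|T| = 20)
    (deg10 : exists v : T, degree v = 10) :
  ~ schur_positive (chromatic_sym T).
Proof.
move=> fpos; case: deg10 => v deg_v.
have [p tree] := @tree_rooted_depth2 T v 10 treeT cardT deg_v fpos.
set N := [set w | adj v w] in tree.
have cardN : #|N| = 10 by exact: deg_v.
have vN := root_notin tree.
have cardL : #|leaves v N| = 9.
  by have := cardsC (v |: N); rewrite cardT cardsU1 vN cardN => -[].
pose s := [seq nleaves v N p j | j <- enum N].
have s10 : size s = 10 by rewrite size_map -cardE.
have s9 : sumn s = 9 by rewrite sumnE big_map big_enum (sum_nleaves tree).
have /negP := not_survives s10 s9; apply; rewrite survivesE.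
have delE : deletion_total s = (\sum_r coloring_poly v p _ [set r])%R.
  rewrite (bigD1 v) //= (bigID (mem N)) /= (coloring_poly_root tree).
  rewrite /deletion_total !big_map !big_enum; congr (_ + (_ + _))%R.
    rewrite [RHS](eq_bigl (mem N)) => [|i]; last first.
      by rewrite andb_idl // => iN; apply: contraNneq vN => <-.
    by apply: eq_bigr => i iN; rewrite (coloring_poly_child tree)
      // cardN cardL.
  rewrite [RHS](eq_bigl (mem (leaves v N))) => [|i];
    last by rewrite /= in_leaves.
  rewrite (eq_bigr (fun=> 'X^10 + 'X^9))%R => [|i iL]; last first.
    by rewrite (coloring_poly_leaf tree) // cardN cardL.
  by rewrite sumr_const cardL mulr_natl.
have edgeE : edge_total s = edge_poly v p _.
  by rewrite (edge_polyE tree) /edge_total !big_map !big_enum.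
rewrite delE edgeE; apply/andP; split.
  (* The two colourings of the whole tree both have classes of ten vertices, which gives 2 in degree
     10 and 0 in degree 12. *)
  have colE a : (#|two_step (@stable_step T) setT a|%:R =
      ('X^10 + 'X^10 : {poly BinNums.Z})`_a)%R.
    by rewrite -setC0 -(coef_coloring_poly tree) (coloring_poly_set0 tree)
      cardN cardL.
  have := schur_positive_three_rows 8 fpos.
  rewrite !chromatic_chains -!natrD ler_nat !chains_delete_vertex ?cardT //
    !chains2.
  rewrite !cardsT cardT !mul1n.
  rewrite -(ler_nat BinNums.Z) !natrD !colE !coefD !coefXn /= addr0.
  rewrite !coef_sum !natr_sum => le_del.
  rewrite !(eq_bigr _ (fun r _ => coef_coloring_poly tree _ _ _)).
  exact: le_del.
have elemE a b : a + b = 20 ->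
    (coef_form (elementary_form a b) (chromatic_sym T) =
     (\sum_(B : {set T} | #|B| == a)
       2 ^ (edges v p B + edges v p (~: B)))%N%:R)%R.
  move=> ab; rewrite (elementary_formE (edge_weight_refl v p)
    (edge_weight_inv tree) a b
    (@stable_stepT T) (@stable_below T)) ab -signr_odd mul1r natr_sum.
  apply: eq_big => B; last by rewrite /edge_weight setD0 setTD -expnD.
  by have := cardsC B; rewrite cardT; case: eqP => //= -> ?; apply/eqP; lia.
rewrite /edge_poly !coef_sum_sets ler_nat -(ler_nat rat).
(* Rewriting from right to left keeps unification away from the 2^18 terms of
   the two elementary forms. *)
rewrite -(elemE 11 9 erefl) -(elemE 10 10 erefl).
exact: (schur_positive_two_columns 8 fpos).
Qed.
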